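(* Let $0<\alpha<1$. There exist a function $f\in\Lambda_{\alpha}(\mathbb{R})$ and a constant $c=c(\alpha)>0$ such that $$\int_{0}^{1}|\Theta_{\varepsilon}(f)(x)|^{2}\,dx\ge c\log(1/\varepsilon)\quad\text{for all }0<\varepsilon<1/2,$$ and $$\limsup_{\varepsilon\to0^{+}}\frac{\Theta_{\varepsilon}(f)(x)}{\sqrt{\log(1/\varepsilon)\,\log\log\log(1/\varepsilon)}}>c\quad\text{for almost every }x\in[0,1].$$
   Context: For $0<\alpha<1$, $\Lambda_{\alpha}(\mathbb{R})$ is the class of functions $f\colon\mathbb{R}\to\mathbb{R}$ for which there exists a constant $C>0$ with $|f(x)-f(y)|\le C|x-y|^{\alpha}$ for all $x,y\in\mathbb{R}$. For $f\in\Lambda_{\alpha}(\mathbb{R})$, $0<\varepsilon<1/2$ and $x\in\mathbb{R}$, $$\Theta_{\varepsilon}(f)(x)=\int_{\varepsilon}^{1}\frac{f(x+h)-f(x-h)}{h^{\alpha}}\,\frac{dh}{h}.$$ *)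

(* Defs.v *)
From mathcomp Require Import all_boot all_order all_algebra.
From mathcomp Require Import all_classical all_reals all_analysis.
Set Implicit Arguments.
Unset Strict Implicit.
Unset Printing Implicit Defensive.
Import Order.TTheory GRing.Theory Num.Theory.
Import numFieldNormedType.Exports.
Local Open Scope classical_set_scope.
Local Open Scope ring_scope.

Definition holder_class (R : realType) (alpha : R) : set (R -> R) :=
  [set f | exists2 C : R, 0 < C &
    forall x y : R, `|f x - f y| <= C * `|x - y| `^ alpha].

(* The measure dh/h is written as a factor h^-1 in the integrand. [powR] agrees
   with the usual real power since h >= eps > 0 on the domain. *)
Definition Theta (R : realType) (alpha eps : R) (f : R -> R) (x : R) : R :=
  \int[@lebesgue_measure R]_(h in `[eps, 1])
    ((f (x + h) - f (x - h)) / h `^ alpha / h).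

(* Main.v *)
Require Import Defs.
From mathcomp Require Import all_boot all_order all_algebra.
From mathcomp Require Import all_classical all_reals all_analysis.
From mathcomp Require Import zify ring lra.
Import Order.TTheory GRing.Theory Num.Theory.
Import numFieldNormedType.Exports.
Local Open Scope classical_set_scope.
Local Open Scope ring_scope.

Set Implicit Arguments.
Unset Strict Implicit.
Unset Printing Implicit Defensive.

(** Take the lacunary series with terms r^n sin(2 pi 2^n x), r = 2^(-alpha).
    The difference of one term at x + h and x - h is 2 r^n cos(2 pi 2^n x)
    sin(2 pi 2^n h), and the substitution u = 2 pi 2^n h turns its truncated
    integral into a constant times cos(2 pi 2^n x) times the integral of sin
    u / u^(1 + alpha) over a window [2 pi 2^n eps, 2 pi 2^n]. For eps of
    order 2^(-N), the parts of the half-line missed by the windows with n <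
    N cost O(1) in total, by two geometric series, and the terms with n >= N
    together contribute O(1) by the crude bound on the tail of the series.
    Hence the truncated integral of the series is D (sum_(n < N) cos(2 pi
    2^n x)) up to a bounded error, uniformly in x ([Theta_lac_close]). The
    constant D is positive because the full sine integral is
    ([sine_constant_gt0]), by comparison with the derivative of (1 - cos u)
    u^(-1 - alpha).

    The cosine sums behave like sums of independent signs. Replacing x by
    the left end of its dyadic interval of generation N changes the sum by a
    bounded amount and leaves a function of the first N binary digits.
    Flipping the leading digit changes the sign of the first cosine and
    nothing else, so the first, second and fourth moments follow by
    induction ([word_sum_mean], [word_sum_var_ge], [word_sum_fourth]), and a
    Paley-Zygmund argument shows that a sum of l cosines is at least sqrt(l) /
    16 for at least 1 / 64 of the words ([word_sum_tail]).

    For the upper limit, let stage k consist of m = floor(log_64 k)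
    consecutive blocks of (k!)^8 digits. Blocks involve disjoint digits, so
    all of them are good with frequency at least 64^(-m) >= 1 / k, and the
    stage then gains an amount of order m sqrt((k!)^8), which is the order
    of sqrt(N log log N) for the number N of digits used so far. As the sum
    of 1 / k diverges, almost every x sees infinitely many successful
    stages; Chebyshev's inequality, with the summable bounds 1 / k^2, shows
    that the digits before stage k do not destroy the gain. This gives
    [lacunary_lil].

    For the energy, the second moment gives at once a multiple of N minus a
    constant, which is useless for eps near 1 / 2. A large multiple of the
    identity function, clamped outside [-1, 2], is therefore added: for x in
    [0, 1] it changes the truncated integral by a quantity that does not
    depend on x and is bounded below. Since the cosine sums have mean zero
    there is no cross term, and the square of that quantity absorbs the
    constant ([example_energy]). *)

(** * Elementary estimates *)

Section preliminaries.
Variable R : realType.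
Implicit Types (a d q x y : R) (n : nat).

Lemma cos_lip x y : `|cos x - cos y| <= `|x - y|.
Proof.
wlog xy : x y / x <= y.
  by move=> H; case: (leP x y) => [|/ltW] /H //; rewrite distrC [leRHS]distrC.
have [c _ E] : exists2 c, c \in `[x, y]%R & cos y - cos x = - sin c * (y - x).
  apply: (@MVT_segment _ _ (fun z => - sin z)) => //.
  by apply: continuous_subspaceT; exact: continuous_cos.
by rewrite distrC E [leRHS]distrC normrM normrN ler_piMl // sin_max.
Qed.

Lemma sin_lip x y : `|sin x - sin y| <= `|x - y|.
Proof.
wlog xy : x y / x <= y.
  by move=> H; case: (leP x y) => [|/ltW] /H //; rewrite distrC [leRHS]distrC.
have [c _ E] : exists2 c, c \in `[x, y]%R & sin y - sin x = cos c * (y - x).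
  apply: (@MVT_segment _ _ cos) => //.
  by apply: continuous_subspaceT; exact: continuous_sin.
by rewrite distrC E [leRHS]distrC normrM ler_piMl // cos_max.
Qed.

Lemma sin_le x : 0 <= x -> `|sin x| <= x.
Proof.
by move=> x0; have := sin_lip x 0; rewrite sin0 !subr0 (ger0_norm x0).
Qed.

Lemma cos_quad x : 0 <= x -> 1 - cos x <= x ^+ 2.
Proof.
move=> x0; have [c] : exists2 c, c \in `[0, x]%R & cos x - cos 0 = - sin c * (x - 0).
  apply: (@MVT_segment _ _ (fun z => - sin z)) => //.
  by apply: continuous_subspaceT; exact: continuous_cos.
rewrite in_itv /= cos0 subr0 => /andP[c0 cx] E.
have : sin c <= x by apply: le_trans cx; apply: le_trans (sin_le c0); apply: ler_norm.
nra.
Qed.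

Lemma sum_pow2 n : \sum_(i < n) 2 ^+ i = 2 ^+ n - 1 :> R.
Proof.
elim: n => [|n IH]; first by rewrite big_ord0 expr0 subrr.
by rewrite big_ord_recr /= IH exprS; ring.
Qed.

Lemma sum_geo x n : (1 - x) * \sum_(i < n) x ^+ i = 1 - x ^+ n.
Proof.
elim: n => [|n IH]; first by rewrite big_ord0 mulr0 expr0 subrr.
by rewrite big_ord_recr /= mulrDr IH exprS; ring.
Qed.

Lemma sum_geo_lt1 x n : 0 <= x -> x < 1 -> \sum_(i < n) x ^+ i <= (1 - x)^-1.
Proof.
move=> x0 x1; have q0 : 0 < 1 - x by rewrite subr_gt0.
by rewrite -[leRHS]mulr1 ler_pdivlMl // sum_geo gerBl exprn_ge0.
Qed.

Lemma sum_geo_gt1 x n : 1 < x -> \sum_(i < n) x ^+ i <= x ^+ n / (x - 1).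
Proof.
move=> x1; have q0 : 0 < x - 1 by rewrite subr_gt0.
rewrite ler_pdivlMr // mulrC -opprB mulNr sum_geo; lra.
Qed.

Lemma dyadic_scale d : 0 < d <= 1 ->
  exists N, 2 ^+ N * d <= 1 <= 2 ^+ N.+1 * d.
Proof.
move=> /andP[d0 d1]; have di0 : 0 <= d^-1 by rewrite invr_ge0 ltW.
have /andP[t1 t2] := truncn_itv di0; set m := Num.truncn _ in t1 t2.
have m1 : (0 < m)%N by rewrite truncn_gt0 invf_ge1.
have /andP[l1 l2] := trunc_log_bounds (isT : 1 < 2)%N m1.
exists (trunc_log 2 m); apply/andP; split.
  rewrite -ler_pdivlMr // div1r; apply: le_trans t1.
  by rewrite -natrX ler_nat.
rewrite -ler_pdivrMr // div1r; apply: ltW; apply: lt_le_trans t2 _.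
by rewrite -natrX ler_nat.
Qed.

Lemma powR_mull q x : 0 < x -> x * x `^ q = x `^ (1 + q).
Proof.
move=> x0; rewrite -{1}(powRr1 (ltW x0)) -powRD //.
by rewrite (gt_eqF x0) implybT.
Qed.

Lemma powRN_le q x y : 0 <= q -> 0 < x -> x <= y -> y `^ (- q) <= x `^ (- q).
Proof.
move=> q0 x0 xy; have y0 := lt_le_trans x0 xy.
rewrite !powRN lef_pV2 ?posrE ?powR_gt0 //.
by apply: ge0_ler_powR; rewrite ?nnegrE ?(ltW x0) ?(ltW y0).
Qed.

Lemma powR_le_root q d x : 0 < q -> 0 < d -> 0 < x -> x <= d `^ q^-1 -> x `^ q <= d.
Proof.
move=> q0 d0 x0 xd.
rewrite -[leRHS](powRr1 (ltW d0)) -(mulVf (lt0r_neq0 q0)) powRrM.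
by apply: ge0_ler_powR; rewrite ?nnegrE ?powR_ge0 ?(ltW x0) ?(ltW q0).
Qed.

Lemma powR_ge_root q d x : 0 < q -> 0 < d -> d `^ q^-1 <= x -> d <= x `^ q.
Proof.
move=> q0 d0 xd.
rewrite -[leLHS](powRr1 (ltW d0)) -(mulVf (lt0r_neq0 q0)) powRrM.
have x0 : 0 <= x := le_trans (powR_ge0 _ _) xd.
by apply: ge0_ler_powR; rewrite ?nnegrE ?powR_ge0 ?(ltW q0).
Qed.

(** The intervals [u i - e i, u i + e i] meet pairwise, so they all contain
    the supremum of their left ends. This yields limits together with their
    rate of convergence: it defines both the sine integral over the half-line
    and the sum of the lacunary series. *)
Lemma sup_nested (I : Type) (P : set I) (u e : I -> R) :
  (forall i j, P i -> P j -> u i <= u j + e i + e j) ->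
  forall i, P i -> `|u i - sup [set u j - e j | j in P]| <= e i.
Proof.
move=> ue i Pi; set S := image _ _.
have ub z : S z -> z <= u i + e i.
  by move=> [j Pj <-]; have := ue j i Pj Pi; lra.
have Si : S (u i - e i) by exists i.
rewrite ler_distl; apply/andP; split.
  by rewrite lerBlDr; apply: ge_sup => //; exists (u i - e i).
by rewrite -lerBlDr; apply: ub_le_sup => //; exists (u i + e i).
Qed.

Lemma holder_continuous alpha (f : R -> R) : 0 < alpha ->
  holder_class alpha f -> continuous f.
Proof.
move=> a0 [C C0 Hf] x; apply/cvgrPdist_le => e e0.
have d0 : 0 < (e / C) `^ alpha^-1 by rewrite powR_gt0 // divr_gt0.
near=> y.
have yx : `|x - y| <= (e / C) `^ alpha^-1.
  by near: y; apply: (@cvgr_dist_le _ _ _ (nbhs x) _ id) => //; apply: cvg_id.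
apply: le_trans (Hf x y) _; rewrite mulrC -ler_pdivlMr //.
have := normr_ge0 (x - y); rewrite le_eqVlt => /predU1P[<-|xy0].
  by rewrite powR0 ?gt_eqF // divr_ge0 ?ltW.
by apply: powR_le_root => //; rewrite divr_gt0.
Unshelve. all: by end_near. Qed.

End preliminaries.

(** * Moments of lacunary cosine sums over dyadic words *)

(** Independence of the leading and trailing digits of an integer below A B.
    *)
Lemma sum_digits (R : pzRingType) (A B : nat) (F H : nat -> R) :
  \sum_(i < A * B) F (i %/ B)%N * H (i %% B)%N =
  (\sum_(i < A) F i) * (\sum_(j < B) H j).
Proof.
elim: A => [|A IH]; first by rewrite mul0n !big_ord0 mul0r.
rewrite mulSn addnC big_split_ord /= IH big_ord_recr /= mulrDl; congr (_ + _).
rewrite mulr_sumr; apply: eq_bigr => j _.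
have jB := ltn_ord j.
by rewrite divnMDl ?divn_small ?addn0 ?modnMDl ?modn_small // (leq_ltn_trans _ jB).
Qed.

Section word_sums.
Variable R : realType.
Implicit Types (l m w n : nat) (x y : R).

Definition cos_sum n x : R := \sum_(i < n) cos (2 ^+ i * (2 * pi * x)).

Definition grid l w : R := w%:R / 2 ^+ l.

(** A word of l binary digits is the integer w < 2^l that they represent, most
    significant digit first; it stands for the dyadic point w / 2^l. *)
Definition word_sum l w : R := cos_sum l (grid l w).

Lemma cosDnat2pi n x : cos (x + n%:R * (2 * pi)) = cos x.
Proof.
elim: n => [|n IH]; first by rewrite mul0r addr0.
by rewrite -addn1 natrD mulrDl mul1r addrA -IH [2 * pi]mulr_natl cosD2pi.
Qed.

Lemma cos_sumDnat n x k : cos_sum n (x + k%:R) = cos_sum n x.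
Proof.
apply: eq_bigr => i _; rewrite -[RHS](cosDnat2pi (2 ^ i * k)).
by congr cos; rewrite natrM natrX; ring.
Qed.

Lemma cos_sumS n x : cos_sum n.+1 x = cos (2 * pi * x) + cos_sum n (2 * x).
Proof.
rewrite /cos_sum big_ord_recl expr0 mul1r; congr (_ + _).
by apply: eq_bigr => i _; congr cos; rewrite /bump /= exprS; ring.
Qed.

Lemma cos_sum_shift m n x :
  cos_sum (m + n) x = cos_sum m x + cos_sum n (2 ^+ m * x).
Proof.
rewrite /cos_sum big_split_ord /=; congr (_ + _).
by apply: eq_bigr => i _; congr cos; rewrite exprD; ring.
Qed.

Lemma word_sumS_low l w :
  word_sum l.+1 w = cos (pi * grid l w) + word_sum l w.
Proof.
by rewrite /word_sum cos_sumS /grid; congr (cos _ + cos_sum _ _);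
  rewrite exprS; field; rewrite expf_neq0.
Qed.

(** The leading digit 1 shifts the first cosine by half a period and all the
    other ones by whole periods. *)
Lemma word_sumS_high l w :
  word_sum l.+1 (2 ^ l + w) = - cos (pi * grid l w) + word_sum l w.
Proof.
have pl : 2 ^+ l != 0 :> R by rewrite expf_neq0.
rewrite /word_sum cos_sumS -(cos_sumDnat l (grid l w) 1) -cosDpi.
by congr (cos _ + cos_sum _ _); rewrite /grid natrD natrX exprS; field.
Qed.

Lemma sum_words_split l (F : nat -> R) :
  \sum_(w < 2 ^ l.+1) F w = \sum_(w < 2 ^ l) (F w + F (2 ^ l + w)%N).
Proof. by rewrite expnS mul2n -addnn big_split_ord /= big_split. Qed.

Lemma word_sum0 w : word_sum 0 w = 0.
Proof. by rewrite /word_sum /cos_sum big_ord0. Qed.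

Lemma word_sum_mean l : \sum_(w < 2 ^ l) word_sum l w = 0.
Proof.
elim: l => [|l IH]; first by rewrite expn0 big_ord1 word_sum0.
rewrite (sum_words_split l (word_sum l.+1)).
rewrite (eq_bigr (fun w : 'I__ => 2 * word_sum l w)); last first.
  by move=> w _; rewrite word_sumS_low word_sumS_high; ring.
by rewrite -mulr_sumr IH mulr0.
Qed.

Lemma cos_le1_sqr x : cos x ^+ 2 <= 1.
Proof. by rewrite -(cos2Dsin2 x) lerDl sqr_ge0. Qed.

Lemma sum_word_sum_sqrS l : \sum_(w < 2 ^ l.+1) word_sum l.+1 w ^+ 2 =
  2 * (\sum_(w < 2 ^ l) word_sum l w ^+ 2 + \sum_(w < 2 ^ l) cos (pi * grid l w) ^+ 2).
Proof.
rewrite (sum_words_split l (fun w => word_sum l.+1 w ^+ 2)) -big_split mulr_sumr.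
by apply: eq_bigr => w _; rewrite word_sumS_low word_sumS_high /=; ring.
Qed.

(** Two words that differ in their leading digit give arguments that differ by
    a quarter period, so their squared cosines add up to 1. *)
Lemma sum_cos_sqr l : 2 ^+ l / 2 <= \sum_(w < 2 ^ l) cos (pi * grid l w) ^+ 2.
Proof.
case: l => [|l].
  rewrite expn0 big_ord1 /grid mul0r mulr0 cos0 !expr0 expr1n; lra.
rewrite (sum_words_split l (fun w => cos (pi * grid l.+1 w) ^+ 2)).
rewrite (eq_bigr (fun=> 1)); last first.
  move=> w _; rewrite [X in _ + cos X ^+ 2](_ : _ = pi * grid l.+1 w + pi / 2).
    by rewrite cosD cos_pihalf mulr0 sin_pihalf mulr1 sub0r sqrrN cos2Dsin2.
  by rewrite /grid natrD natrX exprS; field; rewrite expf_neq0.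
by rewrite sumr_const card_ord exprS mulrC mulKf // natrX.
Qed.

Lemma word_sum_var_ge l :
  l%:R / 2 * 2 ^+ l <= \sum_(w < 2 ^ l) word_sum l w ^+ 2.
Proof.
elim: l => [|l IH]; first by rewrite expn0 big_ord1 word_sum0 !mul0r expr0n.
rewrite sum_word_sum_sqrS; have := sum_cos_sqr l.
move: IH; rewrite exprS -natr1; set S1 := \sum_(_ < _) _; set S2 := \sum_(_ < _) _.
by set P := 2 ^+ l; set L := l%:R => ? ?; lra.
Qed.

Lemma word_sum_var_le l :
  \sum_(w < 2 ^ l) word_sum l w ^+ 2 <= l%:R * 2 ^+ l.
Proof.
elim: l => [|l IH]; first by rewrite expn0 big_ord1 word_sum0 !mul0r expr0n.
rewrite sum_word_sum_sqrS.
have : \sum_(w < 2 ^ l) cos (pi * grid l w) ^+ 2 <= 2 ^+ l.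
  apply: (@le_trans _ _ (\sum_(w < 2 ^ l) 1)).
    by apply: ler_sum => w _; apply: cos_le1_sqr.
  by rewrite sumr_const card_ord natrX.
move: IH; rewrite exprS -natr1; set S1 := \sum_(_ < _) _; set S2 := \sum_(_ < _) _.
by set P := 2 ^+ l; set L := l%:R => ? ?; lra.
Qed.

(** Averaging (v + c)^4 and (v - c)^4 leaves v^4 + 6 v^2 c^2 + c^4: the odd
    powers of the new cosine c cancel. *)
Lemma word_sum_fourth l :
  \sum_(w < 2 ^ l) word_sum l w ^+ 4 <= 3 * l%:R ^+ 2 * 2 ^+ l.
Proof.
elim: l => [|l IH]; first by rewrite expn0 big_ord1 word_sum0 !expr0n !mulr0 mul0r.
apply: (@le_trans _ _ (2 * (\sum_(w < 2 ^ l) word_sum l w ^+ 4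
    + 6 * \sum_(w < 2 ^ l) word_sum l w ^+ 2 + 2 ^+ l))).
  rewrite (sum_words_split l (fun w => word_sum l.+1 w ^+ 4)).
  have -> : 2 ^+ l = \sum_(w < 2 ^ l) 1 :> R by rewrite sumr_const card_ord natrX.
  rewrite mulr_sumr -!big_split mulr_sumr; apply: ler_sum => w _ /=.
  rewrite word_sumS_low word_sumS_high.
  set c := cos _; set v := word_sum l w.
  have c1 : c ^+ 2 <= 1 by apply: cos_le1_sqr.
  have c0 : 0 <= c ^+ 2 by apply: sqr_ge0.
  have v0 : 0 <= v ^+ 2 by apply: sqr_ge0.
  rewrite (_ : _ + _ = 2 * (v ^+ 4 + 6 * (v ^+ 2 * c ^+ 2) + c ^+ 2 * c ^+ 2)); last by ring.
  rewrite ler_pM2l //; apply: lerD; first by rewrite lerD2l ler_pM2l // ler_piMr.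
  by rewrite -[leRHS]mulr1 ler_pM.
have V2 := word_sum_var_le l.
have p0 : 0 < 2 ^+ l :> R by rewrite exprn_gt0.
have l0 : 0 <= l%:R :> R by [].
move: IH V2 p0 l0; rewrite [2 ^+ l.+1]exprS -[l.+1%:R]natr1.
set S1 := \sum_(_ < _) _; set S2 := \sum_(_ < _) _.
by set P := 2 ^+ l; set L := l%:R => *; nra.
Qed.

(** Integrated against a law with mean 0, second moment at least 1 / 2 and
    fourth moment at most 3, the left-hand side is at least 1 / 2 - 3 / 12 - 1
    / 8 = 1 / 8, so that t >= 1 / 16 has probability at least 1 / 56. The
    coefficient 4 / 3 makes the quartic negative for t < 0, since u - u^3 / 12
    <= 4 / 3 for u = - t > 0. *)
Lemma quartic_bound (t : R) :
  4 / 3 * t + t ^+ 2 - t ^+ 4 / 12 - 1 / 8 <= 7 * (1 / 16 <= t)%R%:R.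
Proof.
case: (leP (1 / 16) t) => [t1|t1] /=.
  by rewrite mulr1n; have := sqr_ge0 (t ^+ 2 - 7); have := sqr_ge0 (t - 4); nra.
rewrite mulr0n mulr0.
case: (leP 0 t) => t0; first by have := sqr_ge0 (t ^+ 2); nra.
(* the cubic t^3 - 12 t - 16 = (t - 4) (t + 2)^2 touches 0 at t = -2 *)
have : 0 <= (t * (t - 4)) * (t + 2) ^+ 2.
  by apply: mulr_ge0 (sqr_ge0 _); rewrite nmulr_rge0 // subr_le0; lra.
lra.
Qed.

Definition block_good l w := Num.sqrt l%:R / 16 <= word_sum l w.

(** [quartic_bound] applied to the sums divided by sqrt l; the linear term
    disappears since the mean is zero. *)
Lemma word_sum_tail l : (0 < l)%N ->
  2 ^+ l / 64 <= \sum_(w < 2 ^ l) (block_good l w)%:R :> R.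
Proof.
move=> l0; have l0R : 0 < l%:R :> R by rewrite ltr0n.
set s := Num.sqrt (l%:R : R).
have s0 : 0 < s by rewrite sqrtr_gt0.
have s2 : s ^+ 2 = l%:R by rewrite sqr_sqrtr // ltW.
have V2 := word_sum_var_ge l; have V4 := word_sum_fourth l; have V1 := word_sum_mean l.
have p0 : 0 < 2 ^+ l :> R by rewrite exprn_gt0.
have : \sum_(w < 2 ^ l) (4 / 3 * (word_sum l w / s) + (word_sum l w / s) ^+ 2 -
   (word_sum l w / s) ^+ 4 / 12 - 1 / 8) <= \sum_(w < 2 ^ l) 7 * (block_good l w)%:R.
  apply: ler_sum => w _; rewrite /block_good -/s.
  have -> : (s / 16 <= word_sum l w) = (1 / 16 <= word_sum l w / s).
    by rewrite ler_pdivlMr // mul1r mulrC.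
  exact: quartic_bound.
rewrite -mulr_sumr; set B := \sum_(_ < _) _%:R.
have -> : \sum_(w < 2 ^ l) (4 / 3 * (word_sum l w / s) + (word_sum l w / s) ^+ 2 -
   (word_sum l w / s) ^+ 4 / 12 - 1 / 8) =
  4 / 3 / s * \sum_(w < 2 ^ l) word_sum l w
  + l%:R^-1 * (\sum_(w < 2 ^ l) word_sum l w ^+ 2)
  - (l%:R ^+ 2)^-1 / 12 * (\sum_(w < 2 ^ l) word_sum l w ^+ 4)
  - 2 ^+ l / 8.
  have -> : 2 ^+ l = \sum_(w < 2 ^ l) 1 :> R by rewrite sumr_const card_ord natrX.
  rewrite mulr_suml !mulr_sumr -!sumrN -!big_split /=; apply: eq_bigr => w _.
  by rewrite -s2; field; rewrite gt_eqF.
rewrite V1 mulr0 add0r.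
have : 1 / 2 * 2 ^+ l <= l%:R^-1 * (\sum_(w < 2 ^ l) word_sum l w ^+ 2).
  by rewrite -ler_pdivrMl ?invr_gt0 // invrK; apply: le_trans V2; lra.
have : (l%:R ^+ 2)^-1 / 12 * (\sum_(w < 2 ^ l) word_sum l w ^+ 4) <= 1 / 4 * 2 ^+ l.
  rewrite -mulrA ler_pdivrMl ?exprn_gt0 //.
  by move: V4; set S4 := \sum_(_ < _) _ => V4; lra.
set S2 := \sum_(_ < _) word_sum l _ ^+ 2; set S4 := \sum_(_ < _) _ => *; lra.
Qed.

End word_sums.

(** * Consecutive blocks of binary digits *)

Section blocks.
Variable R : realType.
Implicit Types (l m w n k : nat) (x y : R).

Lemma cos_sum_lip n x y : `|cos_sum n x - cos_sum n y| <= 2 ^+ n * (8 * `|x - y|).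
Proof.
rewrite /cos_sum -sumrB; apply: le_trans (ler_norm_sum _ _ _) _.
apply: (@le_trans _ _ (\sum_(i < n) 2 ^+ i * (8 * `|x - y|))).
  apply: ler_sum => i _; apply: le_trans (cos_lip _ _) _.
  rewrite -mulrBr -mulrBr !normrM (ger0_norm (exprn_ge0 _ _)) // ler_pM2l ?exprn_gt0 //.
  rewrite ler_wpM2r // !ger0_norm ?pi_ge0 //.
  have := pihalf_lt2 R; lra.
rewrite -mulr_suml sum_pow2 ler_wpM2r ?mulr_ge0 //; lra.
Qed.

(** The interval is closed so that the relation also holds at the right ends,
    and [w] may exceed 2^l: only its last l digits matter for 1-periodic
    functions. *)
Definition in_word l w y := w%:R <= 2 ^+ l * y <= w%:R + 1.

(** Moving to the left end of the dyadic interval costs at most sum_(i < l) 2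
    pi 2^i 2^(-l) < 2 pi < 8. *)
Lemma cos_sum_word l w y : in_word l w y ->
  `|cos_sum l y - word_sum R l (w %% 2 ^ l)| <= 8.
Proof.
move=> /andP[y1 y2].
have p0 : 0 < 2 ^+ l :> R by rewrite exprn_gt0.
rewrite /word_sum -(cos_sumDnat l (grid R l (w %% 2 ^ l)) (w %/ 2 ^ l)).
apply: le_trans (cos_sum_lip _ _ _) _.
have -> : grid R l (w %% 2 ^ l) + (w %/ 2 ^ l)%:R = w%:R / 2 ^+ l.
  by rewrite {3}(divn_eq w (2 ^ l)) natrD natrM natrX /grid; field; rewrite gt_eqF.
have -> : y - w%:R / 2 ^+ l = (2 ^+ l * y - w%:R) / 2 ^+ l.
  by field; rewrite gt_eqF.
rewrite normrM normfV (gtr0_norm p0) ger0_norm ?subr_ge0 //.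
rewrite [leLHS](_ : _ = 8 * (2 ^+ l * y - w%:R)); first by lra.
by field; rewrite gt_eqF.
Qed.

Lemma in_word_prefix a l w y : in_word (a + l) w y -> in_word a (w %/ 2 ^ l) y.
Proof.
rewrite /in_word exprD => /andP[y1 y2].
have p0 : 0 < 2 ^+ l :> R by rewrite exprn_gt0.
have r2 : (w %% 2 ^ l)%:R + 1 <= 2 ^+ l :> R.
  by rewrite -natrX natr1 ler_nat ltn_mod expn_gt0.
have r0 : 0 <= (w %% 2 ^ l)%:R :> R by [].
move: y1 y2; rewrite {1 2}(divn_eq w (2 ^ l)) natrD natrM natrX.
set q := (w %/ _)%:R; set r := (w %% _)%:R in r2 r0 *; set P := 2 ^+ l in p0 r2 *.
move=> y1 y2; rewrite -(ler_pM2r p0) -[X in _ && X](ler_pM2r p0) mulrDl mul1r.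
by apply/andP; split; nra.
Qed.

Lemma in_word_suffix a l w y : in_word (a + l) w y -> in_word l w (2 ^+ a * y).
Proof. by rewrite /in_word exprD [2 ^+ a * _]mulrC mulrA. Qed.

(** The word is cut from its right end into [m] words of [l] digits. *)
Fixpoint blocks_good m l w :=
  if m is m'.+1 then blocks_good m' l (w %/ 2 ^ l) && block_good R l (w %% 2 ^ l)
  else true.

Lemma cos_sum_blocks m l w y : in_word (m * l) w y -> blocks_good m l w ->
  m%:R * (Num.sqrt l%:R / 16 - 8) <= cos_sum (m * l) y.
Proof.
elim: m w y => [|m IH] w y; first by rewrite mul0r mul0n /cos_sum big_ord0.
rewrite mulSn addnC => yw /= /andP[gm gl].
rewrite cos_sum_shift -natr1 mulrDl mul1r; apply: lerD.
  exact: IH (in_word_prefix yw) gm.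
have := cos_sum_word (in_word_suffix yw); move: gl.
by rewrite /block_good ler_distl => + /andP[+ _]; lra.
Qed.

(** The blocks are independent, and each of them is good with frequency at
    least 1 / 64. *)
Lemma blocks_good_count m l : (0 < l)%N ->
  2 ^+ (m * l) / 64 ^+ m <= \sum_(w < 2 ^ (m * l)) (blocks_good m l w)%:R :> R.
Proof.
move=> l0; elim: m => [|m IH].
  by rewrite mul0n expn0 big_ord1 /= expr0 divr1.
rewrite mulSn addnC expnD /=.
under eq_bigr => w _ do rewrite -mulnb natrM.
rewrite (sum_digits _ _ (fun w => (blocks_good m l w)%:R) (fun w => (block_good R l w)%:R)).
rewrite [leLHS](_ : _ = (2 ^+ (m * l) / 64 ^+ m) * (2 ^+ l / 64)); last first.
  by rewrite exprD exprS; field; rewrite expf_neq0.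
have := word_sum_tail R l0 => H.
by apply: ler_pM => //; rewrite ?divr_ge0 ?exprn_ge0.
Qed.

Lemma blocks_bad_count m l : (0 < l)%N ->
  \sum_(w < 2 ^ (m * l)) (~~ blocks_good m l w)%:R <= (1 - (64 ^+ m)^-1) * 2 ^+ (m * l) :> R.
Proof.
move=> l0; have := blocks_good_count m l0.
have -> : \sum_(w < 2 ^ (m * l)) (~~ blocks_good m l w)%:R =
   2 ^+ (m * l) - \sum_(w < 2 ^ (m * l)) (blocks_good m l w)%:R :> R.
  have -> : 2 ^+ (m * l) = \sum_(w < 2 ^ (m * l)) 1 :> R by rewrite sumr_const card_ord natrX.
  by rewrite -sumrB; apply: eq_bigr => w _; case: blocks_good; rewrite ?subrr ?subr0.
by rewrite mulrBl mul1r [_^-1 * _]mulrC; lra.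
Qed.

Lemma word_sum_chebyshev n (t : R) : 0 < t ->
  \sum_(w < 2 ^ n) (word_sum R n w < - (t * Num.sqrt n%:R))%R%:R <= 2 ^+ n / t ^+ 2.
Proof.
move=> t0; case: (posnP n) => [->|n0].
  by rewrite expn0 big_ord1 word_sum0 sqrtr0 mulr0 oppr0 ltxx divr_ge0 ?exprn_ge0 // ltW.
have n0R : 0 < n%:R :> R by rewrite ltr0n.
rewrite ler_pdivlMr ?exprn_gt0 // -(ler_pM2r n0R) mulrC.
apply: le_trans (_ : \sum_(w < 2 ^ n) word_sum R n w ^+ 2 <= _); last first.
  by rewrite mulrC word_sum_var_le.
rewrite mulr_suml mulr_sumr; apply: ler_sum => w _.
case: ltP => /= [h|_]; last by rewrite mul0r mulr0 sqr_ge0.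
have s0 : 0 <= t * Num.sqrt n%:R by rewrite mulr_ge0 // ltW.
have -> : n%:R * (1%:R * t ^+ 2) = (t * Num.sqrt n%:R) ^+ 2.
  by rewrite exprMn sqr_sqrtr ?ltW // mul1r mulrC.
by rewrite -[leRHS]sqrrN ler_sqr ?nnegrE //; lra.
Qed.

End blocks.

(** * Almost every point sees large lacunary sums *)

Section stages.
Variable R : realType.
Implicit Types (l m w n k N j : nat) (x y : R).
Local Notation mu := (@lebesgue_measure R).

(** A finite union of dyadic intervals, whose measure counts words; a point of
    the unit interval belongs to it according to its first [N] digits. *)
Definition cylinder N (P : nat -> bool) : set R :=
  \big[setU/set0]_(w < 2 ^ N)
    (if P w then `[w%:R / 2 ^+ N, w.+1%:R / 2 ^+ N[%classic else set0).

Lemma cylinder_measurable N P : measurable (cylinder N P).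
Proof. by apply: bigsetU_measurable => w _; case: ifP. Qed.

Lemma cylinder_measure N P :
  (mu (cylinder N P) <= ((\sum_(w < 2 ^ N) (P w)%:R) / 2 ^+ N)%:E)%E.
Proof.
pose F w := if P w then `[w%:R / 2 ^+ N, w.+1%:R / 2 ^+ N[%classic else (set0 : set R).
have mF w : measurable (F w) by rewrite /F; case: ifP.
have H : (mu (cylinder N P) <= \sum_(w < 2 ^ N) mu (F w))%E.
  by apply: (@content_subadditive _ _ _ mu _ F (2 ^ N)%N) => [k _||]; [exact: mF|exact: cylinder_measurable|].
apply: (le_trans H).
rewrite mulr_suml -sumEFin; apply: lee_sum => w _; rewrite /F; case: (P w) => /=.
  rewrite lebesgue_measure_itv /= lte_fin ltr_pM2r ?invr_gt0 ?exprn_gt0 // ltr_nat ltnSn.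
  by rewrite -EFinD -mulrBl -natr1 addrAC subrr add0r.
by rewrite measure0 mul0r.
Qed.

Definition word N x := Num.truncn (2 ^+ N * x).

Lemma word_bounds N x : 0 <= x ->
  (word N x)%:R <= 2 ^+ N * x < (word N x)%:R + 1.
Proof.
move=> x0; have /truncn_itv : 0 <= 2 ^+ N * x by rewrite mulr_ge0 ?exprn_ge0.
by rewrite -[(Num.truncn _).+1%:R]natr1.
Qed.

Lemma word_in_word N x : 0 <= x -> in_word N (word N x) x.
Proof. by move=> /(word_bounds N)/andP[x1 /ltW x2]; rewrite /in_word x1 x2. Qed.

Lemma word_lt N x : 0 <= x < 1 -> (word N x < 2 ^ N)%N.
Proof.
move=> /andP[x0 x1]; have /andP[t1 _] := word_bounds N x0.
by rewrite -(ltr_nat R) natrX (le_lt_trans t1) // gtr_pMr // exprn_gt0.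
Qed.

(** Forgetting the last digits of the expansion of x. *)
Lemma word_prefix a l x : 0 <= x -> (word (a + l) x %/ 2 ^ l)%N = word a x.
Proof.
move=> x0; apply/esym/truncn_def; have /andP[] := word_bounds (a + l) x0.
rewrite exprD; set w := word _ _.
have p0 : 0 < 2 ^+ l :> R by rewrite exprn_gt0.
have r2 : (w %% 2 ^ l)%:R + 1 <= 2 ^+ l :> R.
  by rewrite -natrX natr1 ler_nat ltn_mod expn_gt0.
have r0 : 0 <= (w %% 2 ^ l)%:R :> R by [].
rewrite {1 2}(divn_eq w (2 ^ l)) natrD natrM natrX -[X in _ && (_ < X)]natr1.
set q := (w %/ _)%:R; set r := (w %% _)%:R in r2 r0 *; set P := 2 ^+ l in p0 r2 *.
move=> y1 y2; rewrite -(ler_pM2r p0) -[X in _ && X](ltr_pM2r p0) mulrDl mul1r.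
by apply/andP; split; nra.
Qed.

Lemma cylinderP N (P : nat -> bool) x : 0 <= x < 1 -> P (word N x) -> cylinder N P x.
Proof.
move=> x01 Pw; have x0 : 0 <= x by case/andP: x01.
rewrite /cylinder -(bigcup_mkord _ (fun w => if P w then `[w%:R / 2 ^+ N, w.+1%:R / 2 ^+ N[%classic else set0)).
exists (word N x); first exact: word_lt.
rewrite Pw /= in_itv /= ler_pdivrMr ?exprn_gt0 // ltr_pdivlMr ?exprn_gt0 //.
by rewrite -[X in _ && (_ < X)]natr1 mulrC word_bounds.
Qed.

(** The base 64 matches the frequency of a good block: stage k succeeds with
    frequency at least 64^(- log_64 k) >= 1 / k, a divergent series. *)
Definition reps k := trunc_log 64 k.
(** The lengths grow so fast that the number of all digits before stage k,
    even multiplied by k^6, is at most the length of a single block of stage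
    k, while log log of the number of digits is only of order log k. *)
Definition block_len k := (k`! ^ 8)%N.
Fixpoint stage_end k := if k is k'.+1 then (stage_end k' + reps k * block_len k)%N else 0%N.

Lemma block_len_gt0 k : (0 < block_len k)%N.
Proof. by rewrite expn_gt0 fact_gt0. Qed.

Lemma reps_le k : (reps k <= k)%N.
Proof.
case: k => [|k] //; have /andP[+ _] := trunc_log_bounds (isT : 1 < 64)%N (ltn0Sn k).
by apply: leq_trans; apply/ltnW/ltn_expl.
Qed.

Lemma reps_gt0 k : (64 <= k)%N -> (0 < reps k)%N.
Proof. by move=> k64; rewrite trunc_log_gt0 /= k64. Qed.

Lemma block_lenS k : block_len k.+1 = (k.+1 ^ 8 * block_len k)%N.
Proof. by rewrite /block_len factS expnMn. Qed.

Lemma stage_end_le k : (stage_end k <= k ^ 2 * block_len k)%N.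
Proof.
elim: k => [|k IH] //=.
apply: leq_trans (leq_add IH (leq_mul (reps_le k.+1) (leqnn _))) _.
rewrite block_lenS mulnA -mulnDl mulnA leq_pmul2r ?block_len_gt0 //.
have : (1 <= k.+1 ^ 8)%N by rewrite expn_gt0.
nia.
Qed.

(** All the stages k0 + 1, ..., k0 + j fail. *)
Fixpoint all_fail k0 j w :=
  if j is j'.+1 then
    let k := (k0 + j)%N in let b := (reps k * block_len k)%N in
    all_fail k0 j' (w %/ 2 ^ b)%N && ~~ blocks_good R (reps k) (block_len k) (w %% 2 ^ b)
  else true.

(** The product of the 1 - 1 / k for k0 < k <= k0 + j telescopes. *)
Lemma all_fail_count k0 j : (0 < k0)%N ->
  \sum_(w < 2 ^ stage_end (k0 + j)) (all_fail k0 j w)%:R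
    <= k0%:R / (k0 + j)%:R * 2 ^+ stage_end (k0 + j) :> R.
Proof.
move=> k00; elim: j => [|j IH].
  by rewrite addn0 divff ?pnatr_eq0 -?lt0n // mul1r sumr_const card_ord natrX.
rewrite addnS /=; set k := (k0 + j).+1.
set b := (reps k * block_len k)%N; rewrite expnD.
under eq_bigr => w _ do rewrite addnS -/k -mulnb natrM.
rewrite (sum_digits _ _ (fun w => (all_fail k0 j w)%:R)
  (fun w => (~~ blocks_good R (reps k) (block_len k) w)%:R)).
have Hb := blocks_bad_count R (reps k) (block_len_gt0 k).
have Hq : 1 - (64 ^+ reps k)^-1 <= (k0 + j)%:R / k%:R :> R.
  have -> : (k0 + j)%:R / k%:R = 1 - k%:R^-1 :> R.
    have -> : (k0 + j)%:R = k%:R - 1 :> R by rewrite /k -[_.+1%:R]natr1 addrK.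
    by rewrite mulrBl divff ?pnatr_eq0 // mul1r.
  rewrite lerD2l lerN2 lef_pV2 ?posrE ?exprn_gt0 ?ltr0n // -natrX ler_nat.
  by have /andP[] := trunc_log_bounds (isT : 1 < 64)%N (ltn0Sn (k0 + j)).
have {Hb} Hb : \sum_(w < 2 ^ b) (~~ blocks_good R (reps k) (block_len k) w)%:R <=
    (k0 + j)%:R / k%:R * 2 ^+ b :> R.
  by apply: le_trans Hb _; rewrite ler_pM2r ?exprn_gt0.
rewrite [leRHS](_ : _ = (k0%:R / (k0 + j)%:R * 2 ^+ stage_end (k0 + j)) *
   ((k0 + j)%:R / k%:R * 2 ^+ b)); last first.
  have p0 : k%:R != 0 :> R by rewrite pnatr_eq0.
  have q0 : (k0 + j)%:R != 0 :> R by rewrite pnatr_eq0 addn_eq0 negb_and -lt0n k00.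
  move: p0 q0; rewrite exprD; set p := k%:R; set q := (k0 + j)%:R => p0 q0.
  by field; rewrite -natrD; apply/andP; split.
by apply: ler_pM => //; apply: sumr_ge0.
Qed.

(** The digits before stage [k] contribute an exceptionally negative sum. *)
Definition past_low k w :=
  word_sum R (stage_end k.-1) w < - (k%:R * Num.sqrt (stage_end k.-1)%:R).

(** As soon as k0 >= 64, every point whose cosine sums are not large at the
    ends of the stages k0 + 1, ..., K lies in this set. *)
Definition failure_cover k0 K : set R :=
  cylinder (stage_end K) (all_fail k0 (K - k0)) `|`
  \big[setU/set0]_(i < K - k0) cylinder (stage_end (k0 + i)) (past_low (k0 + i).+1).

Lemma failure_cover_measurable k0 K : measurable (failure_cover k0 K).
Proof.
apply: measurableU; first exact: cylinder_measurable.
by apply: bigsetU_measurable => i _; exact: cylinder_measurable.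
Qed.

Lemma inv_sqr_le (q : R) : 0 < q -> ((q + 1) ^+ 2)^-1 <= q^-1 - (q + 1)^-1.
Proof.
move=> q0; have q1 : 0 < q + 1 by rewrite addr_gt0.
have -> : q^-1 - (q + 1)^-1 = (q * (q + 1))^-1.
  by field; rewrite !gt_eqF.
by rewrite lef_pV2 ?posrE ?exprn_gt0 ?mulr_gt0 // expr2 ler_pM2r // lerDl.
Qed.

Lemma sum_inv_sqr k0 n : (0 < k0)%N ->
  \sum_(i < n) ((k0 + i).+1%:R ^+ 2)^-1 <= k0%:R^-1 - (k0 + n)%:R^-1 :> R.
Proof.
move=> k00; elim: n => [|n IH]; first by rewrite big_ord0 addn0 subrr.
rewrite big_ord_recr /= addnS; apply: le_trans (lerD IH (lexx _)) _.
have q0 : 0 < (k0 + n)%:R :> R by rewrite ltr0n addn_gt0 k00.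
by rewrite -addrA lerD2l addrC lerBlDr addrC -[(k0 + n).+1%:R]natr1 inv_sqr_le.
Qed.

Lemma failure_cover_measure k0 : (0 < k0)%N ->
  (mu (failure_cover k0 (k0 ^ 2)) <= (2 / k0%:R)%:E)%E.
Proof.
move=> k00; have k0R : 0 < k0%:R :> R by rewrite ltr0n.
set K := (k0 ^ 2)%N; have kK : (k0 <= K)%N by rewrite /K -mulnn leq_pmulr.
have mA : measurable (cylinder (stage_end K) (all_fail k0 (K - k0))).
  exact: cylinder_measurable.
have mB : measurable (\big[setU/set0]_(i < K - k0)
    cylinder (stage_end (k0 + i)) (past_low (k0 + i).+1)).
  by apply: bigsetU_measurable => i _; exact: cylinder_measurable.
apply: (le_trans (measureU2 mu mA mB)).
have -> : 2 / k0%:R = k0%:R^-1 + k0%:R^-1 :> R by ring.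
rewrite EFinD; apply: leeD.
  apply: le_trans (cylinder_measure _ _) _.
  have := all_fail_count (K - k0) k00; rewrite subnKC // => H.
  rewrite lee_fin ler_pdivrMr ?exprn_gt0 //; apply: le_trans H _.
  rewrite ler_pM2r ?exprn_gt0 // /K natrX [leLHS](_ : _ = k0%:R^-1) //.
  by field; rewrite gt_eqF.
pose F i := cylinder (stage_end (k0 + i)) (past_low (k0 + i).+1).
have mF i : measurable (F i) by exact: cylinder_measurable.
have H : (mu (\big[setU/set0]_(i < K - k0) F i) <= \sum_(i < K - k0) mu (F i))%E.
  by apply: (@content_subadditive _ _ _ mu _ F (K - k0)%N) => [k _||]; [exact: mF|by apply: bigsetU_measurable => i _; exact: mF|].
apply: (le_trans H).
apply: (@le_trans _ _ (\sum_(i < K - k0) (((k0 + i).+1%:R ^+ 2)^-1)%:E)%E).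
  apply: lee_sum => i _; apply: le_trans (cylinder_measure _ _) _.
  rewrite lee_fin ler_pdivrMr ?exprn_gt0 //.
  have t0 : 0 < (k0 + i).+1%:R :> R by rewrite ltr0n.
  by rewrite [leRHS]mulrC; exact: word_sum_chebyshev t0.
rewrite sumEFin lee_fin; apply: le_trans (sum_inv_sqr _ k00) _.
by rewrite gerBl invr_ge0.
Qed.

Lemma all_fail_word k0 j x : 0 <= x ->
  (forall i, (i < j)%N -> let k := (k0 + i).+1 in
     ~~ blocks_good R (reps k) (block_len k) (word (stage_end k) x %% 2 ^ (reps k * block_len k))) ->
  all_fail k0 j (word (stage_end (k0 + j)) x).
Proof.
move=> x0; elim: j => [|j IH] // H; rewrite addnS /= addnS.
rewrite word_prefix // IH /=; first exact: (H j (ltnSn j)).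
by move=> i ij; apply: H; apply: leqW.
Qed.

End stages.

Section lil.
Variable R : realType.
Implicit Types (l m w n k N j : nat) (x y : R).
Local Notation mu := (@lebesgue_measure R).

Lemma blocks_good_mod m l w :
  blocks_good R m l (w %% 2 ^ (m * l)) = blocks_good R m l w.
Proof.
elim: m w => [|m IH] w //=.
rewrite mulSn addnC expnD -modn_divl IH modn_dvdm //; exact: dvdn_mull.
Qed.

(** All the digits before stage k + 1 times (k + 1)^6 still fit in one block.
    *)
Lemma stage_end_prev k : (stage_end k * k.+1 ^ 6 <= block_len k.+1)%N.
Proof.
rewrite block_lenS; apply: leq_trans (leq_mul (stage_end_le k) (leqnn _)) _.
rewrite mulnAC leq_pmul2r ?block_len_gt0 // (expnD _ 2 6).
by rewrite leq_pmul2r ?expn_gt0 // leq_exp2r.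
Qed.

Lemma sqrt_block_len k : Num.sqrt (block_len k)%:R = k`!%:R ^+ 4 :> R.
Proof.
by rewrite /block_len natrX (exprM _ 4 2) sqrtr_sqr ger0_norm // exprn_ge0.
Qed.

(** The typical size sqrt(N) of the past, even multiplied by the factor k of
    [past_low], is smaller than the square root of the length of one block by
    a factor k^2. *)
Lemma past_small k :
  k.+1%:R ^+ 3 * Num.sqrt (stage_end k)%:R <= Num.sqrt (block_len k.+1)%:R :> R.
Proof.
have -> : k.+1%:R ^+ 3 = Num.sqrt (k.+1%:R ^+ 6) :> R.
  by rewrite (exprM _ 3 2) sqrtr_sqr ger0_norm // exprn_ge0.
rewrite -sqrtrM ?exprn_ge0 //; apply: ler_wsqrtr.
by rewrite mulrC -natrX -natrM ler_nat stage_end_prev.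
Qed.

Lemma fact_le_pow k : (k`! <= k ^ k)%N.
Proof.
elim: k => [|k IH] //; rewrite factS expnS leq_pmul2l //.
by apply: leq_trans IH _; case: k => // k; rewrite leq_exp2r.
Qed.

Lemma stage_end_ge k : (64 <= k)%N -> (k <= stage_end k)%N.
Proof.
case: k => [|k] // k64; apply: leq_trans (leq_addl _ _).
apply: leq_trans (leq_pmull _ (reps_gt0 k64)).
apply: leq_trans (_ : k.+1`! <= _)%N; first by rewrite factS leq_pmulr ?fact_gt0.
by rewrite /block_len -[leqLHS]expn1 leq_pexp2l ?fact_gt0.
Qed.

(** N <= k^2 (k!)^8 gives log N <= k^3, and log k <= 12 m for the number m of
    blocks because k < 64^(m + 1) <= 2^(12 m). *)
Lemma lnln_stage_end k : (64 <= k)%N ->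
  ln (ln (stage_end k)%:R) <= 36 * (reps k)%:R :> R.
Proof.
move=> k64; have k0 : 0 < k%:R :> R by rewrite ltr0n (leq_trans _ k64).
have k64R : 64 <= k%:R :> R by rewrite (ler_nat R 64).
have sk := stage_end_ge k64.
have ln_le (a b : R) : 0 < a -> a <= b -> ln a <= ln b.
  by move=> a0 ab; rewrite ler_ln // posrE // (lt_le_trans a0).
have lns : ln (stage_end k)%:R <= k%:R ^+ 3 :> R.
  apply: (@le_trans _ _ (ln (k%:R ^+ (2 + k * 8)))).
    apply: ln_le; first by rewrite ltr0n (leq_trans _ sk) // (leq_trans _ k64).
    rewrite -natrX ler_nat; apply: leq_trans (stage_end_le k) _.
    by rewrite expnD leq_pmul2l ?expn_gt0 ?(leq_trans _ k64) // expnM leq_exp2r // fact_le_pow.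
  rewrite lnXn // -[_ *+ (2 + _)]mulr_natr natrD natrM.
  have lk : ln k%:R <= k%:R :> R by apply/ltW/ln_sublinear.
  have lk0 : 0 <= ln k%:R :> R by apply: ln_ge0; lra.
  by move: k0 k64R lk lk0; set K := k%:R; set L := ln K => *; nra.
have ls0 : 0 < ln (stage_end k)%:R :> R.
  by apply: ln_gt0; rewrite ltr1n (leq_trans _ sk) // (leq_trans _ k64).
apply: le_trans (ln_le _ _ ls0 lns) _; rewrite lnXn //.
have : ln k%:R <= 12 * (reps k)%:R :> R.
  apply: (@le_trans _ _ (ln (2 ^+ (12 * reps k)))).
    apply: ln_le => //; rewrite -natrX ler_nat.
    apply: leq_trans (ltnW (trunc_log_ltn k (isT : 1 < 64)%N)) _.
    rewrite [X in (X ^ _ <= _)%N](_ : 64 = 2 ^ 6)%N // -expnM leq_exp2l //.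
    have := reps_gt0 k64; rewrite /reps; lia.
  rewrite lnXn // -[_ *+ (12 * _)]mulr_natr natrM mulrC ler_piMr //.
  by have := @le_ln1Dx R 1; apply; lra.
by rewrite -[_ *+ 3]mulr_natr; lra.
Qed.

Lemma sqrt_stage_end k : (64 <= k.+1)%N ->
  Num.sqrt ((stage_end k.+1)%:R * ln (ln (stage_end k.+1)%:R)) <=
  9 * (reps k.+1)%:R * Num.sqrt (block_len k.+1)%:R :> R.
Proof.
move=> k64; set m : R := (reps _)%:R; set s := Num.sqrt (block_len _)%:R.
have m1 : 1 <= m by rewrite ler1n reps_gt0.
have s0 : 0 <= s by rewrite sqrtr_ge0.
have s2 : (block_len k.+1)%:R = s ^+ 2 by rewrite sqr_sqrtr.
have N2 : (stage_end k.+1)%:R <= 2 * m * s ^+ 2.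
  have : (stage_end k.+1 <= 2 * reps k.+1 * block_len k.+1)%N.
    rewrite /= mul2n -addnn mulnDl leq_add2r.
    apply: leq_trans (_ : block_len k.+1 <= _)%N; last by rewrite leq_pmull // reps_gt0.
    by apply: leq_trans (stage_end_prev k); rewrite leq_pmulr // expn_gt0.
  by rewrite -(ler_nat R) [in leRHS]natrM s2 natrM.
have L := lnln_stage_end k64; rewrite -/m in L.
rewrite -[leRHS]ger0_norm ?mulr_ge0 //.
rewrite -sqrtr_sqr; apply: ler_wsqrtr.
apply: (@le_trans _ _ ((stage_end k.+1)%:R * (36 * m))); first by rewrite ler_wpM2l.
apply: (@le_trans _ _ (2 * m * s ^+ 2 * (36 * m))); first by rewrite ler_wpM2r // mulr_ge0 //; lra.
by have : 0 <= m ^+ 2 * s ^+ 2; [rewrite mulr_ge0 // sqr_ge0|lra].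
Qed.

(** The gain of [m] good blocks, minus the past and the discretization errors,
    against the bound of [sqrt_stage_end]. *)
Lemma stage_arith (m s q K : R) :
  1 <= m -> 64 ^+ 4 <= s -> 0 <= q -> 64 <= K -> K ^+ 3 * q <= s ->
  9 * m * s <= 300 * (m * (s / 16 - 8) - K * q - 8).
Proof.
move=> m1 s4 q0 K64 ps.
have Kq : 4096 * (K * q) <= s.
  apply: le_trans ps; rewrite (_ : K ^+ 3 * q = K ^+ 2 * (K * q)); last by ring.
  by apply: ler_wpM2r; [apply: mulr_ge0 => //; lra|rewrite expr2; nra].
have h1 : s <= m * s by rewrite ler_peMl //; lra.
have h2 : 64 ^+ 4 * m <= m * s by rewrite mulrC ler_wpM2l //; lra.
by lra.
Qed.

Lemma stage_success k x : 0 <= x < 1 -> (64 <= k.+1)%N ->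
  blocks_good R (reps k.+1) (block_len k.+1)
    (word (stage_end k.+1) x %% 2 ^ (reps k.+1 * block_len k.+1)) ->
  ~~ past_low R k.+1 (word (stage_end k) x) ->
  Num.sqrt ((stage_end k.+1)%:R * ln (ln (stage_end k.+1)%:R)) <= 300 * cos_sum (stage_end k.+1) x.
Proof.
move=> x01 k64; have x0 : 0 <= x by case/andP: x01.
rewrite blocks_good_mod => gb.
rewrite /past_low -leNgt => np; apply: le_trans (sqrt_stage_end k64) _.
have wx := word_in_word (stage_end k.+1) x0.
have := cos_sum_blocks (in_word_suffix wx) gb.
have := cos_sum_word (word_in_word (stage_end k) x0); rewrite modn_small ?word_lt //.
rewrite ler_distl => /andP[h1 _] h2.
rewrite [stage_end k.+1]/= cos_sum_shift.
have k64R : 64 <= k.+1%:R :> R by rewrite (ler_nat R 64).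
have m1 : 1 <= (reps k.+1)%:R :> R by rewrite ler1n reps_gt0.
have s4 : 64 ^+ 4 <= Num.sqrt (block_len k.+1)%:R :> R.
  rewrite sqrt_block_len; apply: lerXn2r; rewrite ?nnegrE //.
  by apply: le_trans k64R _; rewrite ler_nat fact_geq.
apply: le_trans (stage_arith m1 s4 (sqrtr_ge0 _) k64R (past_small k)) _.
have c300 : 0 < 300 :> R by lra.
rewrite (ler_pM2l c300); move: np h1 h2; rewrite succnK; clear; lra.
Qed.

Definition never_large n : set R := [set x | 0 <= x < 1 /\ forall N, (n <= N)%N ->
  300 * cos_sum N x < Num.sqrt (N%:R * ln (ln N%:R))].

Lemma never_large_cover n k0 : (64 <= k0)%N -> (n <= k0)%N ->
  never_large n `<=` failure_cover k0 (k0 ^ 2).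
Proof.
move=> k64 nk x [x01 H]; set K := (k0 ^ 2)%N.
have x0 : 0 <= x by case/andP: x01.
have kK : (k0 <= K)%N by rewrite /K -mulnn leq_pmulr // (leq_trans _ k64).
(* either the past of some stage is too low, or every stage fails *)
case: (pselect (exists2 i, (i < K - k0)%N &
    past_low R (k0 + i).+1 (word (stage_end (k0 + i)) x))) => [[i iK pl]|np].
  right; rewrite -(bigcup_mkord _ (fun i =>
    cylinder (stage_end (k0 + i)) (past_low R (k0 + i).+1))).
  by exists i => //; apply: cylinderP.
left; apply: cylinderP => //; rewrite -{2}(subnKC kK); apply: all_fail_word => // i iK /=.
apply/negP => gb.
have k1 : (64 <= (k0 + i).+1)%N by apply: leq_trans k64 _; rewrite leqW // leq_addr.
have : Num.sqrt ((stage_end (k0 + i).+1)%:R * ln (ln (stage_end (k0 + i).+1)%:R)) <=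
    300 * cos_sum (stage_end (k0 + i).+1) x.
  by apply: stage_success => //; apply/negP => pl; apply: np; exists i.
apply/negP; rewrite -ltNge; apply: H; apply: leq_trans nk _.
by apply: leq_trans (stage_end_ge k1); rewrite leqW // leq_addr.
Qed.

(** For every k0 >= max(64, n) the set lies in a cover of measure at most 2 /
    k0. *)
Lemma never_large_negligible n : mu.-negligible (never_large n).
Proof.
pose D := [set k | (maxn 64 n <= k)%N].
pose C : set R := \bigcap_(k in D) failure_cover k (k ^ 2).
have mC : measurable C.
  apply: bigcap_measurable => [|k _]; last exact: failure_cover_measurable.
  by exists (maxn 64 n); rewrite /D /=.
exists C; split => //; last first.
  move=> x nx k; rewrite /D /= geq_max => /andP[k64 kn].
  exact: (never_large_cover k64 kn).
apply/eqP; rewrite -measure_le0; apply/lee_addgt0Pr => e e0; rewrite add0e.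
(* large enough for 2 / k <= e *)
pose k := (maxn 64 n + Num.truncn (2 / e))%N.
have k0 : (0 < k)%N by rewrite /k ltn_addr // leq_max.
have k0R : 0 < k%:R :> R by rewrite ltr0n.
apply: (@le_trans _ _ (mu (failure_cover k (k ^ 2)))).
  apply: le_measure; rewrite ?inE //; first exact: failure_cover_measurable.
  by apply: bigcap_inf; rewrite /D /= leq_addr.
apply: le_trans (failure_cover_measure R k0) _; rewrite lee_fin ler_pdivrMr // mulrC -ler_pdivrMr //.
apply/ltW/(lt_le_trans (truncnS_gt _)); rewrite ler_nat /k -add1n leq_add2r.
by rewrite leq_max.
Qed.

(** The lower half of a law of the iterated logarithm, without the sharp
    constant. *)
Theorem lacunary_lil : {ae mu, forall x, x \in `[0, 1[ ->
  forall n, exists2 N, (n <= N)%N &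
    Num.sqrt (N%:R * ln (ln N%:R)) <= 300 * cos_sum N x}.
Proof.
have := negligible_bigcup never_large_negligible.
apply: negligibleS => x /= /not_implyP[]; rewrite in_itv /= => x01 /existsNP[n nE].
exists n => //; split => // N nN; rewrite ltNge; apply/negP => h; apply: nE.
by exists N.
Qed.

End lil.

(** * Integrals of functions continuous on the positive half-line *)

Section integrals.
Variable R : realType.
Implicit Types (f g F : R -> R) (a b c x y s t : R).
Local Notation mu := (@lebesgue_measure R).

(** Kernels u^p are singular at 0 and are integrated over intervals [a, b]
    with a > 0 only. *)
Definition continuous_pos f := forall x, 0 < x -> {for x, continuous f}.

Lemma continuous_pos_within f a b : continuous_pos f -> 0 < a ->
  {within `[a, b], continuous f}.
Proof.
move=> cf a0; apply: continuous_in_subspaceT => x /[!inE] /=.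
by rewrite in_itv /= => /andP[ax _]; apply: cf; apply: lt_le_trans ax.
Qed.

Lemma continuous_pos_integrable f a b : continuous_pos f -> 0 < a ->
  mu.-integrable `[a, b] (EFin \o f).
Proof.
move=> cf a0; apply: continuous_compact_integrable; first exact: segment_compact.
exact: continuous_pos_within.
Qed.

Lemma continuous_posD f g : continuous_pos f -> continuous_pos g ->
  continuous_pos (fun x => f x + g x).
Proof. by move=> cf cg x x0; apply: continuousD; [exact: cf|exact: cg]. Qed.

Lemma continuous_posB f g : continuous_pos f -> continuous_pos g ->
  continuous_pos (fun x => f x - g x).
Proof. by move=> cf cg x x0; apply: continuousB; [exact: cf|exact: cg]. Qed.

Lemma continuous_posM f g : continuous_pos f -> continuous_pos g ->
  continuous_pos (fun x => f x * g x).
Proof. by move=> cf cg x x0; apply: continuousM; [exact: cf|exact: cg]. Qed.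

Lemma continuous_pos_cst c : continuous_pos (fun=> c).
Proof. by move=> x x0; exact: cvg_cst. Qed.

Lemma continuous_pos_continuous f : continuous f -> continuous_pos f.
Proof. by move=> cf x _; exact: cf. Qed.

Lemma continuous_pos_powR p : continuous_pos (fun x => x `^ p).
Proof.
move=> x x0; apply: differentiable_continuous; apply/derivable1_diffP.
by apply: derivable_powR; rewrite in_itv /= x0.
Qed.

Lemma Rintegral_split_integrable f a b c :
  mu.-integrable `[a, c] (EFin \o f) -> a <= b -> b <= c ->
  \int[mu]_(x in `[a, c]) f x = \int[mu]_(x in `[a, b]) f x + \int[mu]_(x in `[b, c]) f x.
Proof.
move=> i1 ab bc; rewrite -(Rintegral_itv_obnd_cbnd (r := b)); last first.
  by apply: integrableS i1 => //; apply: subset_itvr; rewrite bnd_simp.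
by rewrite -(Rintegral_itvB i1) ?bnd_simp // addrC subrK.
Qed.

Lemma Rintegral_split f a b c : continuous_pos f -> 0 < a -> a <= b -> b <= c ->
  \int[mu]_(x in `[a, c]) f x = \int[mu]_(x in `[a, b]) f x + \int[mu]_(x in `[b, c]) f x.
Proof. by move=> cf a0; apply: Rintegral_split_integrable; exact: continuous_pos_integrable. Qed.

Lemma continuous_pos_norm f : continuous_pos f -> continuous_pos (fun x => `|f x|).
Proof. by move=> cf x x0; apply: cvg_norm; exact: cf. Qed.

Lemma FTC_pos F (dF : R -> R) a b : 0 < a -> a <= b ->
  (forall x, 0 < x -> is_derive x 1 F (dF x)) -> continuous_pos dF ->
  \int[mu]_(x in `[a, b]) dF x = F b - F a.
Proof.
move=> a0; rewrite le_eqVlt => /predU1P[<- *|ab dFF cdF].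
  by rewrite subrr set_itv1 Rintegral_set1.
have cF : continuous_pos F.
  move=> x x0; apply: differentiable_continuous; apply/derivable1_diffP.
  by have := dFF x x0 => /@ex_derive.
rewrite /Rintegral (@continuous_FTC2 _ _ F) //.
- exact: continuous_pos_within.
- have b0 : 0 < b by apply: lt_trans ab.
  split.
  + move=> x; rewrite in_itv /= => /andP[ax _].
    by have := dFF x (lt_trans a0 ax) => /@ex_derive.
  + by apply: cvg_at_right_filter; apply: cF.
  + by apply: cvg_at_left_filter; apply: cF.
- move=> x; rewrite in_itv /= => /andP[ax _].
  have := dFF x (lt_trans a0 ax) => d; rewrite derive1E; exact: derive_val.
Qed.

Lemma Rintegral_le f g a b : 0 < a -> continuous_pos f -> continuous_pos g ->
  (forall x, a <= x <= b -> f x <= g x) ->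
  \int[mu]_(x in `[a, b]) f x <= \int[mu]_(x in `[a, b]) g x.
Proof.
move=> a0 cf cg le_fg; apply: le_Rintegral => //; exact: continuous_pos_integrable.
Qed.

Lemma FTC_norm_le F (dF f : R -> R) a b : 0 < a -> a <= b ->
  (forall x, 0 < x -> is_derive x 1 F (dF x)) ->
  continuous_pos dF -> continuous_pos f ->
  (forall x, a <= x <= b -> `|f x| <= dF x) ->
  `|\int[mu]_(x in `[a, b]) f x| <= F b - F a.
Proof.
move=> a0 ab dFF cdF cf le_f; rewrite -(FTC_pos a0 ab dFF cdF).
have H : `|\int[mu]_(x in `[a, b]) f x| <= \int[mu]_(x in `[a, b]) `|f x|.
  by apply: le_normr_Rintegral => //; exact: continuous_pos_integrable.
by apply: le_trans H _; apply: Rintegral_le => //; apply: continuous_pos_norm.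
Qed.

Lemma Rintegral_scale f a b c : 0 < c -> 0 < a -> a <= b -> continuous_pos f ->
  \int[mu]_(x in `[c * a, c * b]) f x = c * \int[mu]_(x in `[a, b]) f (c * x).
Proof.
move=> c0 a0 ab cf.
have d x : is_derive x 1 ( *%R c) c.
  have H := is_deriveZ c (is_derive_id x (1 : R)).
  by apply: (is_derive_eq H); rewrite /GRing.scale /= mulr1.
have cc : continuous ( *%R c) by move=> x; apply: mulrl_continuous.
have dE : derive1 ( *%R c) = cst c.
  by apply/funext => x; rewrite derive1E; exact: derive_val.
have cfc : continuous_pos (fun x => f (c * x)).
  move=> x x0; apply: (@continuous_comp _ _ _ ( *%R c) f); first exact: cc.
  by apply: cf; rewrite mulr_gt0.
rewrite -RintegralZl //; last exact: continuous_pos_integrable.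
rewrite /Rintegral (integration_by_substitution_increasing (F := *%R c)) //.
- by congr fine; apply: eq_integral => x _; rewrite dE /= mulrC.
- by move=> x y _ _ xy; rewrite ltr_pM2l.
- by rewrite dE => x _; apply: cvg_cst.
- by rewrite dE; apply: is_cvg_cst.
- by rewrite dE; apply: is_cvg_cst.
- split.
  + by move=> x _; have := d x => /@ex_derive.
  + by apply: cvg_at_right_filter; apply: cc.
  + by apply: cvg_at_left_filter; apply: cc.
- by apply: continuous_pos_within => //; rewrite mulr_gt0.
Qed.

End integrals.

(** * The sine integral and its positivity *)

Section sine_kernel.
Variables (R : realType) (alpha : R).
Hypotheses (alpha_gt0 : 0 < alpha) (alpha_lt1 : alpha < 1).
Implicit Types (a b c x y s t u : R).
Local Notation mu := (@lebesgue_measure R).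

Lemma kernelE c u : 0 < u -> c / u `^ alpha / u = c * u `^ (- alpha - 1).
Proof.
move=> u0; rewrite powRB ?(gt_eqF u0) ?implybT //.
by rewrite powRN powRr1 ?ltW // mulrA.
Qed.

Lemma is_derive_powRM p c x : 0 < x ->
  is_derive x 1 (fun u : R => c * u `^ p) (c * (p * x `^ (p - 1))).
Proof. by move=> x0; have := is_deriveZ c (is_derive1_powR p x0). Qed.

(** Integrating u^(- alpha): small near 0, where alpha < 1 is needed. *)
Lemma FTC_head a b (f : R -> R) : 0 < a -> a <= b -> continuous_pos f ->
  (forall x, a <= x <= b -> `|f x| <= x `^ (- alpha)) ->
  `|\int[mu]_(x in `[a, b]) f x| <= b `^ (1 - alpha) / (1 - alpha).
Proof.
move=> a0 ab cf H.
have q0 : 0 < 1 - alpha by rewrite subr_gt0.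
apply: le_trans (FTC_norm_le a0 ab (F := fun u => (1 - alpha)^-1 * u `^ (1 - alpha))
  (dF := fun u => u `^ (- alpha)) _ _ cf H) _.
- move=> x x0; apply: is_derive_eq (is_derive_powRM _ _ x0) _.
  by rewrite mulKf ?gt_eqF // addrAC subrr sub0r.
- exact: continuous_pos_powR.
by rewrite mulrC gerBl mulr_ge0 ?powR_ge0 // invr_ge0 ltW.
Qed.

(** Integrating u^(- alpha - 1): small near infinity. *)
Lemma FTC_tail a b c (f : R -> R) : 0 < a -> a <= b -> continuous_pos f ->
  (forall x, a <= x <= b -> `|f x| <= c * x `^ (- alpha - 1)) -> 0 <= c ->
  `|\int[mu]_(x in `[a, b]) f x| <= c * (a `^ (- alpha) / alpha).
Proof.
move=> a0 ab cf H c0.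
apply: le_trans (FTC_norm_le a0 ab (F := fun u => - (c / alpha) * u `^ (- alpha))
  (dF := fun u => c * u `^ (- alpha - 1)) _ _ cf H) _.
- move=> x x0; apply: is_derive_eq (is_derive_powRM _ _ x0) _.
  by rewrite mulrA mulrNN divfK // gt_eqF.
- by apply: continuous_posM; [exact: continuous_pos_cst|exact: continuous_pos_powR].
have H0 : 0 <= c / alpha * b `^ (- alpha) by rewrite !mulr_ge0 ?powR_ge0 // invr_ge0 ltW.
by rewrite [in leRHS]mulrA [in leRHS]mulrAC; lra.
Qed.

Definition sin_ker u : R := sin u * u `^ (- alpha - 1).

Lemma continuous_sin_ker : continuous_pos sin_ker.
Proof.
apply: continuous_posM; last exact: continuous_pos_powR.
exact/continuous_pos_continuous/continuous_sin.
Qed.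

Definition sin_int s t : R := \int[mu]_(u in `[s, t]) sin_ker u.

Lemma sin_int_head a b : 0 < a -> a <= b ->
  `|sin_int a b| <= b `^ (1 - alpha) / (1 - alpha).
Proof.
move=> a0 ab; apply: FTC_head => //; first exact: continuous_sin_ker.
move=> x /andP[ax _]; have x0 := lt_le_trans a0 ax.
rewrite /sin_ker normrM (ger0_norm (powR_ge0 _ _)).
rewrite (_ : x `^ (- alpha) = x * x `^ (- alpha - 1)); last first.
  by rewrite powR_mull //; congr (_ `^ _); ring.
by rewrite ler_wpM2r ?powR_ge0 // sin_le // ltW.
Qed.

Lemma sin_int_tail a b : 0 < a -> a <= b ->
  `|sin_int a b| <= a `^ (- alpha) / alpha.
Proof.
move=> a0 ab; rewrite -[leRHS]mul1r.
apply: (@FTC_tail _ b 1) => //; first exact: continuous_sin_ker.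
move=> x /andP[ax _]; have x0 := lt_le_trans a0 ax.
by rewrite /sin_ker normrM (ger0_norm (powR_ge0 _ _)) ler_wpM2r ?powR_ge0 // sin_max.
Qed.

Lemma sin_int_split a b c : 0 < a -> a <= b -> b <= c ->
  sin_int a c = sin_int a b + sin_int b c.
Proof. by move=> *; apply: Rintegral_split => //; exact: continuous_sin_ker. Qed.

(** What the window [s, t] misses near 0 and near infinity. *)
Definition sin_err s t : R := s `^ (1 - alpha) / (1 - alpha) + t `^ (- alpha) / alpha.

Lemma sin_int_close s t s' t' : 0 < s <= 2 * pi -> 2 * pi <= t ->
  0 < s' <= 2 * pi -> 2 * pi <= t' ->
  sin_int s t <= sin_int s' t' + sin_err s t + sin_err s' t'.
Proof.
move=> /andP[s0 sp] tp /andP[s'0 s'p] t'p.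
have p0 : 0 < 2 * pi :> R by rewrite mulr_gt0 // pi_gt0.
rewrite (sin_int_split s0 sp tp) (sin_int_split s'0 s'p t'p) /sin_err.
have q0 : 0 < 1 - alpha by rewrite subr_gt0.
have head0 u : 0 <= u `^ (1 - alpha) / (1 - alpha).
  by rewrite divr_ge0 ?powR_ge0 // ltW.
have tail0 u : 0 <= u `^ (- alpha) / alpha by rewrite divr_ge0 ?powR_ge0 // ltW.
have h : sin_int s (2 * pi) <= sin_int s' (2 * pi)
    + s `^ (1 - alpha) / (1 - alpha) + s' `^ (1 - alpha) / (1 - alpha).
  case: (leP s s') => [ss|/ltW ss].
    rewrite (sin_int_split s0 ss s'p).
    have := sin_int_head s0 ss; have := head0 s; rewrite ler_norml.
    by move=> ? /andP[? ?]; lra.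
  rewrite (sin_int_split s'0 ss sp).
  have := sin_int_head s'0 ss; have := head0 s'; rewrite ler_norml.
  by move=> ? /andP[? ?]; lra.
have h' : sin_int (2 * pi) t <= sin_int (2 * pi) t'
    + t `^ (- alpha) / alpha + t' `^ (- alpha) / alpha.
  have t0 := lt_le_trans p0 tp; have t'0 := lt_le_trans p0 t'p.
  case: (leP t t') => [ss|/ltW ss].
    rewrite (sin_int_split p0 tp ss).
    have := sin_int_tail t0 ss; have := tail0 t'; rewrite ler_norml.
    by move=> ? /andP[? ?]; lra.
  rewrite (sin_int_split p0 t'p ss).
  have := sin_int_tail t'0 ss; have := tail0 t; rewrite ler_norml.
  by move=> ? /andP[? ?]; lra.
lra.
Qed.

Definition sine_window : set (R * R) :=
  [set p | 0 < p.1 <= 2 * pi /\ 2 * pi <= p.2].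

(** The integral of sin u / u^(1 + alpha) over the half-line, as the common
    point of the nested intervals around its truncations. *)
Definition sine_constant : R :=
  sup [set sin_int p.1 p.2 - sin_err p.1 p.2 | p in sine_window].

Lemma sine_constant_close s t : 0 < s <= 2 * pi -> 2 * pi <= t ->
  `|sin_int s t - sine_constant| <= sin_err s t.
Proof.
move=> hs ht; apply: (@sup_nested _ _ sine_window (fun p => sin_int p.1 p.2)
  (fun p => sin_err p.1 p.2) _ (s, t)); last by split.
by move=> p q [p1 p2] [q1 q2]; exact: sin_int_close.
Qed.

(** Integrating sin u / u^(1 + alpha) by parts leaves this boundary term and
    the integral of a nonnegative function; that is why the sine integral is
    positive. *)
Definition Phi u : R := (1 - cos u) * u `^ (- alpha - 1).
Definition dPhi u : R := sin_ker u - (1 + alpha) * ((1 - cos u) * u `^ (- alpha - 2)).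

Lemma is_derive_Phi x : 0 < x -> is_derive x 1 Phi (dPhi x).
Proof.
move=> x0.
have H1 : is_derive x 1 (fun u : R => 1 - cos u) (sin x).
  have := is_deriveB (is_derive_cst (1 : R) x 1) (is_derive_cos x).
  by move=> H; apply: (is_derive_eq H); rewrite sub0r opprK.
have := is_deriveM H1 (is_derive1_powR (- alpha - 1) x0).
move=> H; apply: (is_derive_eq H); rewrite /dPhi /sin_ker /GRing.scale /=.
by rewrite (_ : - alpha - 1 - 1 = - alpha - 2); ring.
Qed.

Lemma continuous_dPhi : continuous_pos dPhi.
Proof.
apply: continuous_posB; first exact: continuous_sin_ker.
apply: continuous_posM; first exact: continuous_pos_cst.
apply: continuous_posM; last exact: continuous_pos_powR.
apply: continuous_posB; first exact: continuous_pos_cst.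
exact/continuous_pos_continuous/continuous_cos.
Qed.

Lemma Phi_ge0 u : 0 <= Phi u.
Proof. by rewrite /Phi mulr_ge0 ?powR_ge0 // subr_ge0 cos_le1. Qed.

Lemma Phi_small s : 0 < s -> Phi s <= s `^ (1 - alpha).
Proof.
move=> s0; have -> : s `^ (1 - alpha) = s ^+ 2 * s `^ (- alpha - 1).
  rewrite -(powR_mulrn 2 (ltW s0)) -powRD ?(gt_eqF s0) ?implybT //.
  by congr (_ `^ _); ring.
by rewrite /Phi ler_wpM2r ?powR_ge0 // cos_quad // ltW.
Qed.

Lemma dPhi_le x : dPhi x <= sin_ker x.
Proof.
rewrite /dPhi gerBl mulr_ge0 //; first by rewrite addr_ge0 // ltW.
by rewrite mulr_ge0 ?powR_ge0 // subr_ge0 cos_le1.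
Qed.

Lemma sin_int_Phi a b : 0 < a -> a <= b -> Phi b - Phi a <= sin_int a b.
Proof.
move=> a0 ab; rewrite -(FTC_pos a0 ab is_derive_Phi continuous_dPhi).
apply: Rintegral_le => //; [exact: continuous_dPhi|exact: continuous_sin_ker|].
by move=> x _; exact: dPhi_le.
Qed.

Definition gap : R := pi `^ (- (alpha + 2)).

(** On [pi / 2, pi] the cosine is nonpositive, hence the nonnegative remainder
    of the integration by parts is bounded below there. *)
Lemma gap_dPhi x : pi / 2 <= x <= pi -> dPhi x + gap <= sin_ker x.
Proof.
move=> /andP[hx xp]; have pi0 := pi_gt0 R.
have x0 : 0 < x by apply: lt_le_trans hx; rewrite divr_gt0.
have cx : cos x <= 0.
  rewrite (_ : x = x - pi + pi); last by rewrite subrK.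
  by rewrite cosDpi oppr_le0; apply: cos_ge0_pihalf; apply/andP; split; lra.
have gx : gap <= x `^ (- alpha - 2).
  by rewrite /gap -opprD; apply: powRN_le => //; rewrite addr_ge0 // ltW.
have h1 : x `^ (- alpha - 2) <= (1 - cos x) * x `^ (- alpha - 2).
  by rewrite ler_peMl ?powR_ge0 //; lra.
have h2 : (1 - cos x) * x `^ (- alpha - 2) <= (1 + alpha) * ((1 - cos x) * x `^ (- alpha - 2)).
  by rewrite ler_peMl ?(le_trans (powR_ge0 _ _) h1) // lerDl ltW.
by rewrite /dPhi; lra.
Qed.

Lemma sin_int_gap : Phi pi - Phi (pi / 2) + gap * (pi / 2) <= sin_int (pi / 2) pi.
Proof.
have pi0 := pi_gt0 R.
have h0 : 0 < pi / 2 :> R by rewrite divr_gt0.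
have hp : pi / 2 <= pi :> R by lra.
have d x : 0 < x -> is_derive x 1 (fun u => Phi u + gap * u) (dPhi x + gap).
  move=> x0; have H := is_deriveD (is_derive_Phi x0) (is_deriveZ gap (is_derive_id x (1 : R))).
  by apply: (is_derive_eq H); rewrite /GRing.scale /= mulr1.
have c : continuous_pos (fun x => dPhi x + gap).
  by apply: continuous_posD; [exact: continuous_dPhi|exact: continuous_pos_cst].
apply: (@le_trans _ _ (\int[mu]_(x in `[pi / 2, pi]) (dPhi x + gap))).
  by rewrite (FTC_pos h0 hp d c); lra.
apply: Rintegral_le => //; first exact: continuous_sin_ker.
exact: gap_dPhi.
Qed.

Lemma sin_int_lower s t : 0 < s <= pi / 2 -> pi <= t ->
  gap * (pi / 2) - s `^ (1 - alpha) <= sin_int s t.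
Proof.
move=> /andP[s0 sp] tp; have pi0 := pi_gt0 R.
have h0 : 0 < pi / 2 :> R by rewrite divr_gt0.
have hp : pi / 2 <= pi :> R by lra.
rewrite (sin_int_split s0 (le_trans sp hp) tp) (sin_int_split s0 sp hp).
have := sin_int_Phi s0 sp; have := sin_int_gap; have := sin_int_Phi pi0 tp.
have := Phi_ge0 t; have := Phi_small s0; lra.
Qed.

(** The windows [s, t] with s small and t large keep the gain of
    [sin_int_gap], and both the boundary term at s and the error [sin_err s t]
    become negligible. *)
Lemma sine_constant_gt0 : 0 < sine_constant.
Proof.
have pi0 := pi_gt0 R; have q0 : 0 < 1 - alpha by rewrite subr_gt0.
set g := gap * (pi / 2); have g0 : 0 < g by rewrite mulr_gt0 ?divr_gt0 // powR_gt0.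
set B := 1 + (1 - alpha)^-1; have B0 : 0 < B by rewrite addr_gt0 ?invr_gt0.
have d0 : 0 < g / (4 * B) by apply: divr_gt0 => //; apply: mulr_gt0.
have e0 : 0 < g * alpha / 4 by apply: divr_gt0 => //; apply: mulr_gt0.
pose s := Num.min (pi / 2) ((g / (4 * B)) `^ (1 - alpha)^-1).
pose t := Num.max (2 * pi) ((g * alpha / 4)^-1 `^ alpha^-1).
have s0 : 0 < s by rewrite lt_min divr_gt0 // powR_gt0.
have sp : s <= pi / 2 by rewrite ge_min lexx.
have tp : 2 * pi <= t by rewrite le_max lexx.
have hs : s `^ (1 - alpha) <= g / (4 * B).
  by apply: powR_le_root => //; rewrite ge_min lexx orbT.
have ht : t `^ (- alpha) <= g * alpha / 4.
  rewrite powRN -[leRHS]invrK lef_pV2 ?posrE ?invr_gt0 // ?powR_gt0 //.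
    by apply: powR_ge_root; rewrite ?invr_gt0 // le_max lexx orbT.
  by apply: lt_le_trans tp; rewrite mulr_gt0.
have s2p : 0 < s <= 2 * pi by rewrite s0; lra.
have := sine_constant_close s2p tp; rewrite ler_distl => /andP[_].
have : gap * (pi / 2) - s `^ (1 - alpha) <= sin_int s t.
  by apply: sin_int_lower; [rewrite s0|lra].
rewrite -/g /sin_err.
have : s `^ (1 - alpha) + s `^ (1 - alpha) / (1 - alpha) <= g / 4.
  have -> : s `^ (1 - alpha) + s `^ (1 - alpha) / (1 - alpha) = s `^ (1 - alpha) * B.
    by rewrite /B mulrDr mulr1.
  by rewrite -ler_pdivlMr // -mulrA -invfM.
have : t `^ (- alpha) / alpha <= g / 4 by rewrite ler_pdivrMr // mulrAC.
lra.
Qed.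

End sine_kernel.

(** * The lacunary function and the clamped identity *)

Section lacunary.
Variables (R : realType) (alpha : R).
Hypotheses (alpha_gt0 : 0 < alpha) (alpha_lt1 : alpha < 1).
Implicit Types (x y h d : R) (n N : nat).

Definition lac_ratio : R := 2 `^ (- alpha).
Local Notation r := lac_ratio.

Lemma lac_ratio_gt0 : 0 < r.
Proof. exact: powR_gt0. Qed.

Lemma lac_ratio_lt1 : r < 1.
Proof.
rewrite /lac_ratio powRN invf_lt1 ?powR_gt0 //.
have : 1 `^ alpha < 2 `^ alpha :> R.
  by apply: gt0_ltr_powR; rewrite ?nnegrE //; lra.
by rewrite powR1.
Qed.

Lemma two_lac_ratio : 2 * r = 2 `^ (1 - alpha).
Proof.
rewrite powRD; last by rewrite pnatr_eq0 implybT.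
by rewrite powRr1.
Qed.

Lemma two_lac_ratio_gt1 : 1 < 2 * r.
Proof.
rewrite two_lac_ratio; have : 1 `^ (1 - alpha) < 2 `^ (1 - alpha) :> R.
  by apply: gt0_ltr_powR; rewrite ?nnegrE ?subr_gt0 //; lra.
by rewrite powR1.
Qed.

Lemma lac_ratioX n : (2 ^+ n) `^ (- alpha) = r ^+ n.
Proof.
by rewrite -(powR_mulrn n (ltW lac_ratio_gt0)) -(powR_mulrn n (ler0n R 2)) /lac_ratio -!powRrM mulrC.
Qed.

Lemma two_lac_ratioX n : (2 ^+ n) `^ (1 - alpha) = (2 * r) ^+ n.
Proof.
by rewrite two_lac_ratio -(powR_mulrn n (powR_ge0 _ _)) -(powR_mulrn n (ler0n R 2)) -!powRrM mulrC.
Qed.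

Definition lac_term n x := r ^+ n * sin (2 ^+ n * (2 * pi * x)).

Definition lac_sum N x := \sum_(n < N) lac_term n x.

Definition lac_err N := r ^+ N / (1 - r).

(** The sum of the lacunary series, as the common point of the nested
    intervals around the partial sums. *)
Definition lac x := sup (range (fun N => lac_sum N x - lac_err N)).

Lemma lac_termS n x : `|lac_sum n.+1 x - lac_sum n x| <= lac_err n - lac_err n.+1.
Proof.
have q0 : 0 < 1 - r by rewrite subr_gt0 lac_ratio_lt1.
rewrite /lac_sum big_ord_recr /= addrAC subrr add0r /lac_err exprS -mulrBl.
rewrite (_ : r ^+ n - r * r ^+ n = r ^+ n * (1 - r)); last by ring.
rewrite mulfK ?gt_eqF // normrM (ger0_norm (exprn_ge0 _ (ltW lac_ratio_gt0))).
by apply: ler_piMr; [rewrite exprn_ge0 // ltW // lac_ratio_gt0|exact: sin_max].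
Qed.

Lemma lac_close N x : `|lac_sum N x - lac x| <= lac_err N.
Proof.
apply: (@sup_nested _ _ setT (lac_sum^~ x) lac_err) => // i j _ _ /=.
have e0 n : 0 <= lac_err n.
  by rewrite divr_ge0 ?exprn_ge0 ?subr_ge0 // ltW ?lac_ratio_gt0 ?lac_ratio_lt1.
have up m n : (m <= n)%N -> lac_sum m x - lac_err m <= lac_sum n x - lac_err n.
  move=> mn; apply: (homo_leq (f := fun n => lac_sum n x - lac_err n) (r := <=%R)) mn => //.
    by move=> ? ? ?; apply: le_trans.
  by move=> k; have := lac_termS k x; rewrite ler_norml => /andP[]; lra.
have dn m n : (m <= n)%N -> lac_sum n x + lac_err n <= lac_sum m x + lac_err m.
  move=> mn; apply: (homo_leq (f := fun n => lac_sum n x + lac_err n) (r := fun a b => b <= a)) mn => //.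
    by move=> ? ? ? h1 h2; apply: le_trans h2 h1.
  by move=> k; have := lac_termS k x; rewrite ler_norml /= => /andP[]; lra.
case: (leqP i j) => [/up|/ltnW /dn]; have := e0 i; have := e0 j; lra.
Qed.

Lemma lac_sum_lip N x y : `|lac_sum N x - lac_sum N y| <=
  8 / (2 * r - 1) * ((2 * r) ^+ N * `|x - y|).
Proof.
have q0 : 0 < 2 * r - 1 by rewrite subr_gt0 two_lac_ratio_gt1.
rewrite /lac_sum -sumrB; apply: le_trans (ler_norm_sum _ _ _) _.
apply: (@le_trans _ _ (\sum_(i < N) (2 * r) ^+ i * (8 * `|x - y|))).
  apply: ler_sum => i _; rewrite /lac_term -mulrBr normrM.
  rewrite (ger0_norm (exprn_ge0 _ (ltW lac_ratio_gt0))).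
  rewrite [leRHS](_ : _ = r ^+ i * (2 ^+ i * (8 * `|x - y|))); last first.
    by rewrite exprMn; ring.
  apply: ler_wpM2l; first by rewrite exprn_ge0 // ltW // lac_ratio_gt0.
  apply: le_trans (sin_lip _ _) _.
  rewrite -!mulrBr !normrM (ger0_norm (exprn_ge0 _ _)) // ler_wpM2l ?exprn_ge0 //.
  rewrite ler_wpM2r // !ger0_norm ?pi_ge0 //.
  have := pihalf_lt2 R; lra.
rewrite -mulr_suml.
rewrite [leRHS](_ : _ = (2 * r) ^+ N / (2 * r - 1) * (8 * `|x - y|)); last by ring.
by rewrite ler_wpM2r ?mulr_ge0 // sum_geo_gt1 // two_lac_ratio_gt1.
Qed.

(** For increments of size d = 2^(-N), the first N terms are Lipschitz with
    constants growing like (2 r)^n, and the remaining ones are bounded by the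
    geometric tail; both give r^N, which is d^alpha. *)
Lemma lac_holder : holder_class alpha lac.
Proof.
have r0 := lac_ratio_gt0; have r1 := lac_ratio_lt1; have r2 := two_lac_ratio_gt1.
pose B := 8 / (2 * r - 1) + 2 / (1 - r).
have q1 : 0 < 2 * r - 1 by rewrite subr_gt0.
have q2 : 0 < 1 - r by rewrite subr_gt0.
have B1 : 0 < 8 / (2 * r - 1) by rewrite divr_gt0.
have B2 : 0 < 2 / (1 - r) by rewrite divr_gt0.
have bnd N x y : `|lac x - lac y| <= `|lac_sum N x - lac_sum N y| + 2 / (1 - r) * r ^+ N.
  have := lac_close N x; have := lac_close N y; rewrite /lac_err.
  rewrite (_ : lac x - lac y = (lac_sum N x - lac_sum N y) - (lac_sum N x - lac x)
    + (lac_sum N y - lac y)); last by ring.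
  move=> h1 h2; apply: le_trans (ler_normD _ _) _; apply: le_trans (lerD (ler_normB _ _) (lexx _)) _.
  by rewrite -addrA lerD2l; apply: le_trans (lerD h2 h1) _; rewrite le_eqVlt; apply/orP; left; apply/eqP; ring.
exists (B / r); first by rewrite divr_gt0 // addr_gt0.
move=> x y; set d := `|x - y|.
have [d0|d1] := leP d 1; last first.
  apply: le_trans (bnd 0%N x y) _; rewrite /lac_sum !big_ord0 subrr normr0 add0r expr0 mulr1.
  apply: (@le_trans _ _ B); first by rewrite /B; lra.
  have d1' : 1 <= d `^ alpha.
    have : 1 `^ alpha <= d `^ alpha.
      by apply: ge0_ler_powR; rewrite ?nnegrE ?ltW // (lt_trans ltr01).
    by rewrite powR1.
  have : B <= B / r by rewrite ler_pdivlMr // ler_piMr ?ltW // addr_gt0.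
  by move/le_trans; apply; rewrite ler_peMr // divr_ge0 ?addr_ge0 ?ltW.
have := normr_ge0 (x - y); rewrite -/d le_eqVlt => /predU1P[d00|dp].
  have /eqP : d = 0 by []. rewrite normr_eq0 subr_eq0 => /eqP ->.
  by rewrite subrr normr0 mulr_ge0 ?powR_ge0 // divr_ge0 ?addr_ge0 ?ltW.
have [N /andP[N1 N2]] := dyadic_scale (introT andP (conj dp d0)).
apply: le_trans (bnd N x y) _.
have h1 : `|lac_sum N x - lac_sum N y| <= 8 / (2 * r - 1) * r ^+ N.
  apply: le_trans (lac_sum_lip N x y) _; rewrite -/d ler_pM2l // exprMn mulrAC.
  by rewrite ler_piMl // exprn_ge0 // ltW.
apply: (@le_trans _ _ (B * r ^+ N)); first by rewrite [leRHS]mulrDl lerD2r.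
rewrite -mulrA ler_pM2l ?addr_gt0 // ler_pdivlMl // -exprS -lac_ratioX.
have -> : d `^ alpha = d^-1 `^ (- alpha).
  by rewrite -(powR_inv1 (ltW dp)) -powRrM mulrNN mul1r.
by apply: powRN_le; [exact: ltW|rewrite invr_gt0|rewrite -div1r ler_pdivrMr].
Qed.

(** The identity on [-1, 2], which contains x + h and x - h for x and h in [0,
    1]; clamping makes it Hoelder on the whole line. *)
Definition clamp x : R := Num.min 2 (Num.max (-1) x).

Lemma clamp_id x : -1 <= x <= 2 -> clamp x = x.
Proof. by move=> /andP[x1 x2]; rewrite /clamp (max_idPr x1) (min_idPr x2). Qed.

Lemma clamp_itv x : -1 <= clamp x <= 2.
Proof. by rewrite /clamp le_min ge_min lexx le_max lexx /= andbT; lra. Qed.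

Lemma clamp_lip x y : `|clamp x - clamp y| <= `|x - y|.
Proof.
wlog xy : x y / x <= y.
  by move=> H; case: (leP x y) => [|/ltW] /H //; rewrite distrC [leRHS]distrC.
rewrite distrC [leRHS]distrC [leRHS]ger0_norm ?subr_ge0 // ler_norml.
by rewrite /clamp /Num.min /Num.max; case: (ltP (-1) x) => ?; case: (ltP (-1) y) => ?; do 2?[case: ltP => ?]; apply/andP; split; lra.
Qed.

Lemma clamp_holder : holder_class alpha clamp.
Proof.
exists 3 => // x y; set d := `|x - y|.
have d0 : 0 <= d by exact: normr_ge0.
have [d1|d1] := leP d 1.
  apply: le_trans (clamp_lip x y) _; rewrite -/d.
  have [->|dp] := eqVneq d 0; first by rewrite mulr_ge0 ?powR_ge0.
  have dp' : 0 < d by rewrite lt_neqAle eq_sym dp.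
  have : d <= d `^ alpha by apply: ger1_powR; [rewrite dp' d1|exact: ltW].
  have := powR_ge0 d alpha; lra.
have : 1 `^ alpha <= d `^ alpha.
  by apply: ge0_ler_powR; rewrite ?nnegrE // ltW.
rewrite powR1 => d1'.
have : `|clamp x - clamp y| <= 3.
  by have := clamp_itv x; have := clamp_itv y; rewrite ler_norml => /andP[? ?] /andP[? ?]; apply/andP; split; lra.
lra.
Qed.

End lacunary.

(** * The truncated integral of the lacunary function *)

Section theta.
Variables (R : realType) (alpha : R).
Hypotheses (alpha_gt0 : 0 < alpha) (alpha_lt1 : alpha < 1).
Implicit Types (f g : R -> R) (x y h d eps : R) (n N : nat).
Local Notation mu := (@lebesgue_measure R).
Local Notation r := (lac_ratio alpha).

Definition sym_diff f x h := (f (x + h) - f (x - h)) * h `^ (- alpha - 1).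

Lemma continuous_sym_diff f x : continuous f -> continuous_pos (sym_diff f x).
Proof.
move=> cf; apply: continuous_posM; last exact: continuous_pos_powR.
apply: continuous_posB => h _.
  apply: (@continuous_comp _ _ _ (fun h => x + h) f); last exact: cf.
  by apply: continuousD; [exact: cvg_cst|exact: cvg_id].
apply: (@continuous_comp _ _ _ (fun h => x - h) f); last exact: cf.
by apply: continuousB; [exact: cvg_cst|exact: cvg_id].
Qed.

Lemma ThetaE eps f x : 0 < eps ->
  Theta alpha eps f x = \int[mu]_(h in `[eps, 1]) sym_diff f x h.
Proof.
move=> e0; apply: eq_Rintegral => h; rewrite inE /= in_itv /= => /andP[eh _].
by rewrite kernelE // (lt_le_trans e0).
Qed.

Lemma ThetaD eps f g x : 0 < eps -> continuous f -> continuous g ->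
  Theta alpha eps (fun y => f y + g y) x = Theta alpha eps f x + Theta alpha eps g x.
Proof.
move=> e0 cf cg; rewrite !ThetaE // -RintegralD //; last first.
- by apply: continuous_pos_integrable => //; exact: continuous_sym_diff.
- by apply: continuous_pos_integrable => //; exact: continuous_sym_diff.
by apply: eq_Rintegral => h _; rewrite /sym_diff; ring.
Qed.

Lemma ThetaZ eps c f x : 0 < eps -> continuous f ->
  Theta alpha eps (fun y => c * f y) x = c * Theta alpha eps f x.
Proof.
move=> e0 cf; rewrite !ThetaE // -RintegralZl //; last first.
  by apply: continuous_pos_integrable => //; exact: continuous_sym_diff.
by apply: eq_Rintegral => h _; rewrite /sym_diff; ring.
Qed.

Lemma Theta_bounded eps f x c : 0 < eps <= 1 -> continuous f -> 0 <= c ->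
  (forall y, `|f y| <= c) ->
  `|Theta alpha eps f x| <= 2 * c * (eps `^ (- alpha) / alpha).
Proof.
move=> /andP[e0 e1] cf c0 fc; rewrite ThetaE //.
apply: FTC_tail e1 _ _ _ => //; rewrite ?mulr_ge0 //; first exact: continuous_sym_diff.
move=> h _; rewrite /sym_diff normrM (ger0_norm (powR_ge0 _ _)) ler_wpM2r ?powR_ge0 //.
by apply: le_trans (ler_normB _ _) _; have := fc (x + h); have := fc (x - h); lra.
Qed.

(** Truncation at a fixed eps > 0 makes the kernel integrable, so the
    regularity of f passes to its truncated integral. *)
Lemma Theta_holder eps f : 0 < eps <= 1 -> holder_class alpha f ->
  holder_class alpha (Theta alpha eps f).
Proof.
move=> e01 Hf; have cf := holder_continuous alpha_gt0 Hf.
have /andP[e0 e1] := e01; case: Hf => C C0 Hf.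
exists (2 * C * (eps `^ (- alpha) / alpha)).
  by rewrite !mulr_gt0 ?invr_gt0 ?powR_gt0.
move=> x y; rewrite !ThetaE // -RintegralB //; last first.
- by apply: continuous_pos_integrable => //; exact: continuous_sym_diff.
- by apply: continuous_pos_integrable => //; exact: continuous_sym_diff.
rewrite mulrAC; apply: FTC_tail e1 _ _ _ => //.
- by apply: continuous_posB; exact: continuous_sym_diff.
- move=> h _; rewrite /sym_diff -mulrBl normrM (ger0_norm (powR_ge0 _ _)).
  rewrite ler_wpM2r ?powR_ge0 //.
  rewrite (_ : _ - _ - _ = (f (x + h) - f (y + h)) - (f (x - h) - f (y - h))); last by ring.
  apply: le_trans (ler_normB _ _) _; apply: le_trans (lerD (Hf _ _) (Hf _ _)) _.
  rewrite (_ : x + h - (y + h) = x - y); last by ring.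
  by rewrite (_ : x - h - (y - h) = x - y); [lra|ring].
by rewrite !mulr_ge0 ?powR_ge0 // ltW.
Qed.

Lemma continuous_Theta eps f : 0 < eps <= 1 -> holder_class alpha f ->
  continuous (Theta alpha eps f).
Proof. by move=> e0 /(Theta_holder e0); exact: holder_continuous. Qed.

Lemma sinB_sym x y : sin (x + y) - sin (x - y) = 2 * cos x * sin y.
Proof. by rewrite sinD sinB; ring. Qed.

Lemma continuous_sin_scale n : continuous (fun h : R => sin (2 ^+ n * (2 * pi * h))).
Proof.
move=> h; apply: (@continuous_comp _ _ _ (fun h : R => 2 ^+ n * (2 * pi * h)) sin).
  apply: (@continuous_comp _ _ _ ( *%R (2 * pi)) ( *%R (2 ^+ n))); exact: mulrl_continuous.
exact: continuous_sin.
Qed.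

Lemma continuous_lac_sum N : continuous (lac_sum alpha N).
Proof.
elim: N => [|N IH].
  rewrite (_ : lac_sum alpha 0 = cst 0); first exact: cst_continuous.
  by apply/funext => x; rewrite /lac_sum big_ord0.
rewrite (_ : lac_sum alpha N.+1 = lac_sum alpha N \+ lac_term alpha N); last first.
  by apply/funext => x; rewrite /lac_sum big_ord_recr.
move=> x; apply: continuousD; first exact: IH.
apply: continuousM; first exact: cvg_cst.
exact: continuous_sin_scale.
Qed.

(** The factor that multiplies cos(2 pi 2^n x) in the truncated integral of
    the n-th term, up to 2 r^n. *)
Definition mode n eps := \int[mu]_(h in `[eps, 1])
  (sin (2 ^+ n * (2 * pi * h)) * h `^ (- alpha - 1)).

Lemma continuous_mode n :
  continuous_pos (fun h => sin (2 ^+ n * (2 * pi * h)) * h `^ (- alpha - 1)).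
Proof.
apply: continuous_posM; last exact: continuous_pos_powR.
exact/continuous_pos_continuous/continuous_sin_scale.
Qed.

Lemma Theta_lac_sum N eps x : 0 < eps ->
  Theta alpha eps (lac_sum alpha N) x =
  \sum_(n < N) 2 * cos (2 ^+ n * (2 * pi * x)) * (r ^+ n * mode n eps).
Proof.
move=> e0; elim: N => [|N IH].
  rewrite big_ord0 ThetaE // -[RHS](@Rintegral_set0 _ _ _ mu (fun=> 0)).
  rewrite [RHS]Rintegral_set0 -(mul0r (fine (mu `[eps, 1]))) -Rintegral_cst //.
  by apply: eq_Rintegral => h _; rewrite /sym_diff /lac_sum !big_ord0 subrr mul0r.
rewrite big_ord_recr /= -IH !ThetaE // /mode mulrA -RintegralZl //; last first.
  by apply: continuous_pos_integrable => //; exact: continuous_mode.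
rewrite -RintegralD //; last first.
- apply: continuous_pos_integrable => //.
  by apply: continuous_posM; [exact: continuous_pos_cst|exact: continuous_mode].
- apply: continuous_pos_integrable => //.
  exact/continuous_sym_diff/continuous_lac_sum.
apply: eq_Rintegral => h _; rewrite /sym_diff /lac_sum !big_ord_recr /=.
rewrite /lac_term.
have := sinB_sym (2 ^+ N * (2 * pi * x)) (2 ^+ N * (2 * pi * h)).
rewrite -mulrDr -mulrDr -mulrBr -mulrBr => E.
rewrite (_ : 2 * cos _ * r ^+ N * (_ * _) =
  r ^+ N * (2 * cos (2 ^+ N * (2 * pi * x)) * sin (2 ^+ N * (2 * pi * h))) * h `^ (- alpha - 1)); last by ring.
by rewrite -E; ring.
Qed.

Definition freq n : R := 2 ^+ n * (2 * pi).

Lemma freq_gt0 n : 0 < freq n.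
Proof. by rewrite !mulr_gt0 ?exprn_gt0 ?pi_gt0. Qed.

(** The substitution u = 2 pi 2^n h; the powers of 2^n cancel since r = 2^(-
    alpha). *)
Lemma mode_sin_int n eps : 0 < eps <= 1 ->
  r ^+ n * mode n eps = (2 * pi) `^ alpha * sin_int alpha (freq n * eps) (freq n).
Proof.
move=> /andP[e0 e1]; have f0 := freq_gt0 n.
rewrite /sin_int -[X in `[_, X]]mulr1 Rintegral_scale //; last exact: continuous_sin_ker.
have -> : \int[mu]_(x in `[eps, 1]) sin_ker alpha (freq n * x) =
    freq n `^ (- alpha - 1) * mode n eps.
  rewrite /mode -RintegralZl //; last first.
    by apply: continuous_pos_integrable => //; exact: continuous_mode.
  apply: eq_Rintegral => h; rewrite inE /= in_itv /= => /andP[eh _].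
  rewrite /sin_ker powRM ?ltW // ?(lt_le_trans e0 eh) //.
  by rewrite /freq -!mulrA mulrCA.
suff -> : r ^+ n = (2 * pi) `^ alpha * (freq n * freq n `^ (- alpha - 1)) by rewrite !mulrA.
have -> : freq n * freq n `^ (- alpha - 1) = freq n `^ (- alpha).
  by rewrite powR_mull //; congr (_ `^ _); ring.
have p0 : 0 < 2 * pi :> R by rewrite mulr_gt0 ?pi_gt0.
rewrite /freq; move: (2 * pi) p0 => p p0.
rewrite powRM ?exprn_ge0 ?(ltW p0) // lac_ratioX mulrCA powRN divff ?mulr1 //.
by rewrite gt_eqF // powR_gt0.
Qed.

Definition theta_const : R := 2 * (2 * pi) `^ alpha * sine_constant alpha.

Lemma theta_const_gt0 : 0 < theta_const.
Proof.
by rewrite !mulr_gt0 ?powR_gt0 ?mulr_gt0 ?pi_gt0 // sine_constant_gt0.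
Qed.

Definition mode_err : R := (2 * pi) `^ (1 - alpha) / (1 - alpha) / (2 * r - 1) + (1 - r)^-1 / alpha.

Lemma sin_err_freq N n eps : (n < N)%N -> 0 < eps -> 2 ^+ N * eps <= 1 ->
  sin_err alpha (freq n * eps) (freq n) <=
  (2 * pi) `^ (1 - alpha) / (1 - alpha) * ((2 * r) ^+ n / (2 * r) ^+ N) + r ^+ n / alpha.
Proof.
move=> nN e0 Ne; rewrite /sin_err.
have p0 : 0 < 2 * pi :> R by rewrite mulr_gt0 ?pi_gt0.
have q0 : 0 < 1 - alpha by rewrite subr_gt0.
apply: lerD; last first.
  rewrite ler_pM2r ?invr_gt0 // -lac_ratioX; apply: powRN_le; rewrite ?exprn_gt0 //; first exact: ltW.
  rewrite /freq ler_peMr ?exprn_ge0 //; have := pi_ge2 R; lra.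
rewrite [leRHS]mulrAC ler_pM2r ?invr_gt0 // /freq.
move: (2 * pi) p0 => p p0.
have P0 k : 0 < 2 ^+ k :> R by rewrite exprn_gt0.
rewrite (_ : 2 ^+ n * p * eps = p * (2 ^+ n * eps)); last by ring.
rewrite powRM ?(ltW p0) //; last by rewrite mulr_ge0 ?ltW.
rewrite ler_pM2l ?powR_gt0 // -!two_lac_ratioX ler_pdivlMr ?powR_gt0 // -powRM ?mulr_ge0 ?(ltW (P0 _)) ?(ltW e0) //.
have h0 : 0 <= 2 ^+ n * eps * 2 ^+ N by rewrite !mulr_ge0 // ltW.
apply: ge0_ler_powR; rewrite ?nnegrE ?(ltW (P0 n)) ?(ltW q0) //.
by rewrite -mulrA ler_piMr ?(ltW (P0 n)) // mulrC.
Qed.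

(** For n < N the windows [2 pi 2^n eps, 2 pi 2^n] nearly exhaust the
    half-line, with errors that sum to a geometric series from either end. *)
Lemma Theta_lac_sum_close N eps x : 0 < eps -> 2 ^+ N * eps <= 1 ->
  `|Theta alpha eps (lac_sum alpha N) x - theta_const * cos_sum N x|
    <= 2 * (2 * pi) `^ alpha * mode_err.
Proof.
move=> e0 Ne; rewrite Theta_lac_sum // /cos_sum mulr_sumr -sumrB.
have P1 : 1 <= 2 ^+ N :> R by rewrite exprn_ege1 // ler1n.
have e1 : eps <= 1 by apply: le_trans Ne; rewrite ler_peMl // ltW.
have p0 : 0 < 2 * pi :> R by rewrite mulr_gt0 ?pi_gt0.
apply: le_trans (ler_norm_sum _ _ _) _.
apply: (@le_trans _ _ (\sum_(n < N) 2 * (2 * pi) `^ alpha *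
  ((2 * pi) `^ (1 - alpha) / (1 - alpha) * ((2 * r) ^+ n / (2 * r) ^+ N) + r ^+ n / alpha))).
  apply: ler_sum => n _; rewrite mode_sin_int ?e0 //.
  set c := cos _; set J := sin_int _ _ _.
  rewrite (_ : _ - _ = c * (2 * (2 * pi) `^ alpha * (J - sine_constant alpha))); last first.
    by rewrite /theta_const; ring.
  rewrite normrM; apply: le_trans (ler_piMl (normr_ge0 _) (cos_max _)) _.
  rewrite normrM (ger0_norm (_ : 0 <= 2 * (2 * pi) `^ alpha)) ?mulr_ge0 ?powR_ge0 //.
  rewrite ler_pM2l ?mulr_gt0 ?powR_gt0 //.
  apply: le_trans (sin_err_freq (ltn_ord n) e0 Ne).
  have n1 : 1 <= 2 ^+ n :> R by rewrite exprn_ege1 // ler1n.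
  have ne : 2 ^+ n * eps <= 1.
    by apply: le_trans Ne; rewrite ler_pM2r // ler_eXn2l ?ltr1n // ltnW.
  apply: sine_constant_close => //.
    rewrite mulr_gt0 ?freq_gt0 //= /freq mulrAC.
    by rewrite -[leRHS]mul1r ler_pM2r.
  by rewrite /freq ler_peMl // ltW.
rewrite -mulr_sumr ler_pM2l ?mulr_gt0 ?powR_gt0 // big_split /= -mulr_sumr -!mulr_suml.
have r0 := lac_ratio_gt0 alpha; have r1 := lac_ratio_lt1 alpha_gt0; have r2 := two_lac_ratio_gt1 alpha_lt1.
rewrite /mode_err; apply: lerD.
  rewrite ler_wpM2l ?mulr_ge0 ?powR_ge0 ?invr_ge0 ?subr_ge0 ?(ltW alpha_lt1) //.
  rewrite ler_pdivrMr ?exprn_gt0 ?mulr_gt0 // [leRHS]mulrC.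
  exact: sum_geo_gt1.
by rewrite ler_pM2r ?invr_gt0 // sum_geo_lt1 // ltW.
Qed.

Definition lac_const : R := 2 * (2 * pi) `^ alpha * mode_err + 2 / (1 - r) / r / alpha.

(** The tail of the series after N terms is of size r^N, and truncation at eps
    costs eps^(- alpha), which is of order r^(- N). *)
Lemma Theta_lac_close N eps x : 0 < eps -> 2 ^+ N * eps <= 1 <= 2 ^+ N.+1 * eps ->
  `|Theta alpha eps (lac alpha) x - theta_const * cos_sum N x| <= lac_const.
Proof.
move=> e0 /andP[N1 N2].
have r0 := lac_ratio_gt0 alpha; have r1 := lac_ratio_lt1 alpha_gt0.
have P1 : 1 <= 2 ^+ N :> R by rewrite exprn_ege1 // ler1n.
have e1 : eps <= 1 by apply: le_trans N1; rewrite ler_peMl // ltW.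
have cl : continuous (lac alpha).
  by apply: (holder_continuous alpha_gt0); exact: lac_holder.
have cs := @continuous_lac_sum N.
have cd : continuous (fun y => lac alpha y - lac_sum alpha N y).
  by move=> y; apply: continuousB; [exact: cl|exact: cs].
have -> : Theta alpha eps (lac alpha) x = Theta alpha eps (lac_sum alpha N) x +
    Theta alpha eps (fun y => lac alpha y - lac_sum alpha N y) x.
  by rewrite -ThetaD //; congr Theta; apply/funext => y; rewrite addrC subrK.
rewrite addrAC; apply: le_trans (ler_normD _ _) _; apply: lerD.
  exact: Theta_lac_sum_close.
have e01 : 0 < eps <= 1 by rewrite e0.
have err0 : 0 <= lac_err alpha N by rewrite divr_ge0 ?exprn_ge0 ?subr_ge0 ?ltW.
apply: le_trans (Theta_bounded x e01 cd err0 _) _.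
  by move=> y; rewrite distrC; exact: lac_close.
have h : eps `^ (- alpha) <= (r ^+ N.+1)^-1.
  rewrite -lac_ratioX !powRN invrK -div1r ler_pdivrMr ?powR_gt0 // -powRM ?exprn_ge0 ?(ltW e0) //.
  have : 1 `^ alpha <= (2 ^+ N.+1 * eps) `^ alpha.
    by apply: ge0_ler_powR; rewrite ?nnegrE ?(ltW alpha_gt0) // (le_trans ler01).
  by rewrite powR1.
apply: (@le_trans _ _ (2 * lac_err alpha N * ((r ^+ N.+1)^-1 / alpha))).
  by apply: ler_wpM2l; [exact: mulr_ge0|rewrite ler_pM2r ?invr_gt0].
rewrite /lac_err exprS le_eqVlt; apply/orP; left; apply/eqP.
have rN : r ^+ N != 0 by rewrite gt_eqF // exprn_gt0.
have r1' : 1 - r != 0 by rewrite gt_eqF // subr_gt0.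
by field; rewrite rN r1' !gt_eqF.
Qed.

Lemma Theta_clamp eps x : 0 < eps <= 1 -> 0 <= x <= 1 ->
  Theta alpha eps (@clamp R) x = \int[mu]_(h in `[eps, 1]) (2 * h * h `^ (- alpha - 1)).
Proof.
move=> /andP[e0 e1] /andP[x0 x1]; rewrite ThetaE //.
apply: eq_Rintegral => h; rewrite inE /= in_itv /= => /andP[eh h1].
rewrite /sym_diff !clamp_id; first by rewrite (_ : x + h - (x - h) = 2 * h) //; ring.
  by apply/andP; split; lra.
by apply/andP; split; lra.
Qed.

(** The integrand is 2 h^(- alpha) >= 2. *)
Lemma clamp_int_ge eps : 0 < eps <= 1 ->
  2 * (1 - eps) <= \int[mu]_(h in `[eps, 1]) (2 * h * h `^ (- alpha - 1)).
Proof.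
move=> /andP[e0 e1].
have cc : continuous_pos (fun h : R => 2 * h * h `^ (- alpha - 1)).
  apply: continuous_posM; last exact: continuous_pos_powR.
  exact/continuous_pos_continuous/mulrl_continuous.
apply: (@le_trans _ _ (\int[mu]_(h in `[eps, 1]) 2)).
  have d x : is_derive x 1 ( *%R 2) (2 : R).
    have H := is_deriveZ (2 : R) (is_derive_id x (1 : R)).
    by apply: (is_derive_eq H); rewrite /GRing.scale /= mulr1.
  by rewrite (FTC_pos e0 e1 (fun x _ => d x) (@continuous_pos_cst R 2)) mulr1; lra.
apply: Rintegral_le => //; first exact: continuous_pos_cst.
move=> h /andP[eh h1]; have h0 : 0 < h by apply: lt_le_trans eh.
have -> : 2 * h * h `^ (- alpha - 1) = 2 * h `^ (- alpha).
  by rewrite -mulrA powR_mull //; congr (_ * (_ `^ _)); ring.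
rewrite ler_peMr // powRN invf_ge1 ?powR_gt0 //.
have : h `^ alpha <= 1 `^ alpha.
  by apply: ge0_ler_powR; rewrite ?nnegrE ?(ltW alpha_gt0) ?(ltW h0).
by rewrite powR1.
Qed.

End theta.

(** * Energy on the unit interval *)

Section step.
Variable R : realType.
Local Notation mu := (@lebesgue_measure R).

Lemma continuous_integrable (F : R -> R) a b : continuous F ->
  mu.-integrable `[a, b] (EFin \o F).
Proof.
move=> cF; apply: continuous_compact_integrable; first exact: segment_compact.
exact: continuous_subspaceT.
Qed.

Lemma Rintegral_const (a b c : R) : a <= b -> \int[mu]_(x in `[a, b]) c = c * (b - a).
Proof.
move=> ab; rewrite Rintegral_cst //; congr (_ * _).
have E : fine (lebesgue_measure (`[a, b]%classic : set R)) = b - a.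
  rewrite lebesgue_measure_itv /= lte_fin; case: ltP => //= ba.
  by rewrite (_ : a = b) ?subrr //; apply/eqP; rewrite eq_le ab.
exact: E.
Qed.

(** Only a lower bound by a step function is needed, and the intervals may be
    added one at a time. *)
Lemma Rintegral_step (F : R -> R) (v : nat -> R) (n : nat) : continuous F -> (0 < n)%N ->
  (forall w x, (w < n)%N -> w%:R <= n%:R * x <= w%:R + 1 -> v w <= F x) ->
  (\sum_(w < n) v w) / n%:R <= \int[mu]_(x in `[0, 1]) F x.
Proof.
move=> cF n0 vF; have n0R : 0 < n%:R :> R by rewrite ltr0n.
suff H k : (k <= n)%N ->
    (\sum_(w < k) v w) / n%:R <= \int[mu]_(x in `[0, k%:R / n%:R]) F x.
  by have := H n (leqnn n); rewrite divff // gt_eqF.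
elim: k => [|k IH] kn.
  by rewrite big_ord0 !mul0r set_itv1 Rintegral_set1.
have kk : k%:R / n%:R <= k.+1%:R / n%:R :> R by rewrite ler_pM2r ?invr_gt0 // ler_nat.
have k0 : 0 <= k%:R / n%:R :> R by rewrite divr_ge0.
rewrite (Rintegral_split_integrable (continuous_integrable _ _ cF) k0 kk).
rewrite big_ord_recr /= mulrDl; apply: lerD; first by apply: IH; exact: ltnW.
apply: (@le_trans _ _ (\int[mu]_(x in `[k%:R / n%:R, k.+1%:R / n%:R]) v k)).
  by rewrite Rintegral_const // -mulrBl -[k.+1%:R]natr1 addrAC subrr add0r mul1r.
apply: le_Rintegral => //.
- by apply: continuous_integrable; exact: cst_continuous.
- exact: continuous_integrable.
move=> x; rewrite /= in_itv /= ler_pdivrMr // ler_pdivlMr // mulrC -[k.+1%:R]natr1 => H.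
exact: vF.
Qed.

End step.

Section main.
Variables (R : realType) (alpha : R).
Hypotheses (alpha_gt0 : 0 < alpha) (alpha_lt1 : alpha < 1).
Local Notation mu := (@lebesgue_measure R).
Local Notation D := (theta_const alpha).
Local Notation C := (lac_const alpha).

(** The multiple [K] of the clamped identity serves the energy bound for eps
    near 1 / 2; for K >= 0 it only increases the truncated integrals on the
    unit interval. *)
Definition example K (x : R) := lac alpha x + K * clamp x.

Lemma holderD (f g : R -> R) : holder_class alpha f -> holder_class alpha g ->
  holder_class alpha (fun x => f x + g x).
Proof.
move=> [A A0 fA] [B B0 gB]; exists (A + B); first exact: addr_gt0.
move=> x y; rewrite (_ : _ - _ = (f x - f y) + (g x - g y)); last by ring.
by apply: le_trans (ler_normD _ _) _; rewrite mulrDl; apply: lerD.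
Qed.

Lemma holderZ (k : R) (f : R -> R) : holder_class alpha f ->
  holder_class alpha (fun x => k * f x).
Proof.
move=> [A A0 fA]; exists ((1 + `|k|) * A); first by rewrite mulr_gt0 // ltr_pwDl.
move=> x y; rewrite -mulrBr normrM -mulrA.
apply: ler_pM => //; first by rewrite lerDr.
Qed.

Lemma example_holder K : holder_class alpha (example K).
Proof.
by apply: holderD; [exact: lac_holder|apply: holderZ; exact: clamp_holder].
Qed.

(** The truncated integral of the clamped identity at any point of the unit
    interval. *)
Definition drift eps : R := \int[mu]_(h in `[eps, 1]) (2 * h * h `^ (- alpha - 1)).

Lemma Theta_example K N eps x : 0 < eps -> 2 ^+ N * eps <= 1 <= 2 ^+ N.+1 * eps ->
  0 <= x <= 1 ->
  `|Theta alpha eps (example K) x - (D * cos_sum N x + K * drift eps)| <= C.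
Proof.
move=> e0 Ne x01; have /andP[N1 N2] := Ne.
have e1 : eps <= 1.
  by apply: le_trans N1; rewrite ler_peMl ?(ltW e0) // exprn_ege1 // ler1n.
have cl : continuous (lac alpha).
  by apply: (holder_continuous alpha_gt0); exact: lac_holder.
have cc : continuous (@clamp R).
  by apply: (holder_continuous alpha_gt0); exact: clamp_holder.
have ck : continuous (fun y => K * clamp y).
  by apply: (holder_continuous alpha_gt0); apply: holderZ; exact: clamp_holder.
rewrite /example ThetaD // ThetaZ // Theta_clamp ?e0 // -/(drift eps).
rewrite opprD addrACA subrr addr0; exact: Theta_lac_close.
Qed.

Definition total_err : R := C + 8 * D.
(** Large enough for half the square of slope * drift to exceed the square of
    [total_err] by 1. *)
Definition slope : R := 2 * (total_err + 1).

Lemma lac_const_ge0 : 0 <= C.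
Proof.
have h : 2 ^+ 0 * (1 : R) <= 1 <= 2 ^+ 1 * (1 : R) by rewrite expr0 expr1 !mulr1 lexx ler1n.
by apply: le_trans (Theta_lac_close alpha_gt0 alpha_lt1 0 ltr01 h); exact: normr_ge0.
Qed.

Lemma drift_ge1 eps : 0 < eps -> eps <= 1 / 2 -> 1 <= drift eps.
Proof.
move=> e0 e1; have e01 : 0 < eps <= 1 by rewrite e0; lra.
by apply: le_trans (clamp_int_ge alpha_gt0 e01); lra.
Qed.

(** On every dyadic interval the truncated integral is u + e with |e| <=
    [total_err] and u = D V + slope * drift for the word sum V; then (u + e)^2
    >= u^2 / 2 - e^2, and averaging u^2 leaves no cross term. *)
Lemma example_energy eps : 0 < eps -> eps < 1 / 2 ->
  Num.min (D ^+ 2 / 4) 1 * ln (1 / eps) <=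
  \int[mu]_(x in `[0, 1]) (`|Theta alpha eps (example slope) x| ^+ 2).
Proof.
move=> e0 e1; have e01 : 0 < eps <= 1 by rewrite e0; lra.
have [N Ne] := dyadic_scale e01; have /andP[N1 N2] := Ne.
have D0 : 0 < D := theta_const_gt0 alpha_gt0 alpha_lt1.
have M1 := drift_ge1 e0 (ltW e1); set M := drift eps in M1.
have C0 := lac_const_ge0.
have E0 : 0 <= total_err by rewrite addr_ge0 // mulr_ge0 // ltW.
pose v w : R := (D * word_sum R N w + slope * M) ^+ 2 / 2 - total_err ^+ 2.
have P0 : 0 < 2 ^+ N :> R by rewrite exprn_gt0.
have H : (\sum_(w < 2 ^ N) v w) / (2 ^ N)%:R <=
    \int[mu]_(x in `[0, 1]) (`|Theta alpha eps (example slope) x| ^+ 2).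
  apply: Rintegral_step.
  - have cT := continuous_Theta alpha_gt0 e01 (example_holder slope).
    move=> x; rewrite (_ : (fun x => _) =
      (fun x => Theta alpha eps (example slope) x * Theta alpha eps (example slope) x)).
      by apply: continuousM; exact: cT.
    by apply/funext => y; rewrite real_normK ?num_real // expr2.
  - by rewrite expn_gt0.
  move=> w x wN wx; rewrite natrX in wx.
  have x01 : 0 <= x <= 1.
    have /andP[w1 w2] := wx; apply/andP; split.
      by rewrite -(pmulr_rge0 _ P0) (le_trans _ w1).
    rewrite -(ler_pM2l P0) mulr1 (le_trans w2) // natr1 -natrX ler_nat.
    exact: wN.
  have := Theta_example slope e0 Ne x01; rewrite -/M.
  have := cos_sum_word (wx : in_word N w x); rewrite modn_small //.
  set V := word_sum R N w; set T := cos_sum N x; set Th := Theta _ _ _ _.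
  move=> h1 h2; rewrite real_normK ?num_real // /v -/V.
  have h : `|Th - (D * V + slope * M)| <= total_err.
    rewrite (_ : _ - _ = (Th - (D * T + slope * M)) + D * (T - V)); last by ring.
    apply: le_trans (ler_normD _ _) _; apply: lerD => //.
    by rewrite normrM (gtr0_norm D0) mulrC ler_pM2r.
  have : (Th - (D * V + slope * M)) ^+ 2 <= total_err ^+ 2.
    by rewrite -[X in X <= _]real_normK ?num_real // lerXn2r // nnegrE.
  (* (u + e)^2 - u^2 / 2 + e^2 = (u + 2 e)^2 / 2 *)
  set U := D * V + slope * M; have := sqr_ge0 (U + 2 * (Th - U)); nra.
apply: le_trans H; rewrite ler_pdivlMr ?ltr0n ?expn_gt0 // natrX.
have -> : \sum_(w < 2 ^ N) v w = D ^+ 2 / 2 * (\sum_(w < 2 ^ N) word_sum R N w ^+ 2)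
   + D * slope * M * (\sum_(w < 2 ^ N) word_sum R N w)
   + (slope ^+ 2 * M ^+ 2 / 2 - total_err ^+ 2) * 2 ^+ N.
  have -> : 2 ^+ N = \sum_(w < 2 ^ N) 1 :> R by rewrite sumr_const card_ord natrX.
  by rewrite !mulr_sumr -!big_split /=; apply: eq_bigr => w _; rewrite /v; field.
rewrite word_sum_mean mulr0 addr0.
have V2 := word_sum_var_ge R N.
have lN : ln (1 / eps) <= N%:R + 1.
  apply: (@le_trans _ _ (ln (2 ^+ N.+1))).
    rewrite ler_ln ?posrE ?exprn_gt0 ?divr_gt0 //.
    by rewrite ler_pdivrMr.
  rewrite lnXn // -[_ *+ N.+1]mulr_natr -[N.+1%:R]natr1 ler_piMl //.
  by have := @le_ln1Dx R 1; apply; lra.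
have l0 : 0 <= ln (1 / eps) by apply: ln_ge0; rewrite ler_pdivlMr // mul1r; lra.
set m := Num.min _ _.
have m1 : m <= 1 by rewrite ge_min lexx orbT.
have m2 : m <= D ^+ 2 / 4 by rewrite ge_min lexx.
have m0 : 0 < m by rewrite lt_min ltr01 andbT divr_gt0 // exprn_gt0.
have h1 : m * ln (1 / eps) <= D ^+ 2 / 4 * N%:R + 1.
  apply: (@le_trans _ _ (m * (N%:R + 1))); first by rewrite ler_pM2l.
  by rewrite mulrDr mulr1; apply: lerD => //; rewrite ler_wpM2r.
have h2 : 1 <= slope ^+ 2 * M ^+ 2 / 2 - total_err ^+ 2.
  have : slope ^+ 2 <= slope ^+ 2 * M ^+ 2 by rewrite ler_peMr ?sqr_ge0 // exprn_ege1.
  rewrite /slope; have := E0; nra.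
have h3 : D ^+ 2 / 4 * N%:R * 2 ^+ N <= D ^+ 2 / 2 * (\sum_(w < 2 ^ N) word_sum R N w ^+ 2).
  rewrite (_ : _ * 2 ^+ N = D ^+ 2 / 2 * (N%:R / 2 * 2 ^+ N)); last by field.
  by rewrite ler_pM2l // divr_gt0 // exprn_gt0.
apply: (@le_trans _ _ ((D ^+ 2 / 4 * N%:R + 1) * 2 ^+ N)); first by rewrite ler_pM2r.
by rewrite mulrDl; apply: lerD => //; rewrite ler_pM2r.
Qed.

End main.

(** * The upper limit *)

Section limsup.
Variables (R : realType) (alpha : R).
Hypotheses (alpha_gt0 : 0 < alpha) (alpha_lt1 : alpha < 1).
Local Notation mu := (@lebesgue_measure R).
Local Notation D := (theta_const alpha).
Local Notation C := (lac_const alpha).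

Lemma ln_inv_pow2 N : ln (1 / (2 ^+ N)^-1) = N%:R * ln 2 :> R.
Proof. by rewrite div1r invrK lnXn // mulr_natl. Qed.

Lemma ln2_bounds : 0 < ln (2 : R) <= 1.
Proof.
rewrite ln_gt0 ?ltr1n //=; have := @le_ln1Dx R 1.
by rewrite (_ : 1 + 1 = 2) //; apply; lra.
Qed.

Lemma large_scale : exists N0, forall N, (N0 <= N)%N ->
  [/\ 0 < ln (ln (N%:R * ln 2)) :> R, 1 <= ln (ln (N%:R : R)) & (600 * C / D) ^+ 2 <= N%:R].
Proof.
have /andP[l0 l1] := ln2_bounds.
(* each of the three summands takes care of one of the conditions *)
pose B := expR (expR 1) + (expR 1 + 1) / ln 2 + (600 * C / D) ^+ 2 : R.
exists (Num.truncn B).+1 => N hN.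
have BN : B <= N%:R by apply/ltW/(lt_le_trans (truncnS_gt _)); rewrite ler_nat.
have p1 : 0 < expR (expR 1) :> R by exact: expR_gt0.
have p2 : 0 < expR 1 :> R by exact: expR_gt0.
have p3 : 0 < (expR 1 + 1) / ln 2 :> R by rewrite divr_gt0 // addr_gt0.
have p4 := sqr_ge0 (600 * C / D).
split; last by rewrite /B in BN; lra.
- have : expR 1 + 1 <= N%:R * ln 2 :> R.
    by rewrite -ler_pdivrMr //; rewrite /B in BN; lra.
  move=> h; apply: ln_gt0; rewrite -[ltLHS]expRK ltr_ln ?posrE //; lra.
- have : expR (expR 1) <= N%:R :> R by rewrite /B in BN; lra.
  move=> h; have : expR 1 <= ln (N%:R : R).
    by rewrite -[leLHS]expRK ler_ln ?posrE // (lt_le_trans p1 h).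
  by move=> h'; rewrite -[leLHS]expRK ler_ln ?posrE // (lt_le_trans p2 h').
Qed.

(** For large N the bounded error is at most half of D times the cosine sum,
    and replacing log(1 / eps) = N log 2 by N only increases the denominator.
    *)
Lemma Theta_large K N x : 0 <= K -> (0 < N)%N -> 0 <= x <= 1 ->
  0 < ln (ln (N%:R * ln 2)) :> R -> 1 <= ln (ln (N%:R : R)) ->
  (600 * C / D) ^+ 2 <= N%:R ->
  Num.sqrt (N%:R * ln (ln N%:R)) <= 300 * cos_sum N x ->
  D / 600 <= Theta alpha (2 ^+ N)^-1 (example alpha K) x /
    Num.sqrt (ln (1 / (2 ^+ N)^-1) * ln (ln (ln (1 / (2 ^+ N)^-1)))).
Proof.
move=> K0 N0 x01 ll l1 hC hT; rewrite ln_inv_pow2; set eps := (2 ^+ N)^-1.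
have /andP[l20 l21] := ln2_bounds.
have D0 : 0 < D := theta_const_gt0 alpha_gt0 alpha_lt1.
have C0 := lac_const_ge0 alpha_gt0 alpha_lt1.
have NR : 0 < N%:R :> R by rewrite ltr0n.
have P0 : 0 < 2 ^+ N :> R by rewrite exprn_gt0.
have e0 : 0 < eps by rewrite invr_gt0.
have Ne : 2 ^+ N * eps <= 1 <= 2 ^+ N.+1 * eps.
  rewrite /eps exprS -mulrA divff ?gt_eqF // lexx /= mulr1 ler1n //.
have e1 : eps <= 1 / 2.
  rewrite /eps div1r lef_pV2 ?posrE // -[leLHS]expr1 ler_eXn2l // ltr1n //.
have M1 := drift_ge1 alpha_gt0 e0 e1.
have := Theta_example alpha_gt0 alpha_lt1 K e0 Ne x01; rewrite ler_distl => /andP[+ _].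
set Th := Theta _ _ _ _; set S := Num.sqrt (N%:R * ln 2 * _).
set G := Num.sqrt _ in hT.
have SG : S <= G.
  have Nl : N%:R * ln 2 <= N%:R :> R by rewrite ler_piMr // ltW.
  have l3 : 0 < ln (N%:R * ln 2) :> R.
    rewrite ltNge; apply/negP => h; move: ll; rewrite ln0 ?ltxx //.
  have l4 : ln (N%:R * ln 2) <= ln N%:R :> R by rewrite ler_ln ?posrE // mulr_gt0.
  have l5 : ln (ln (N%:R * ln 2)) <= ln (ln N%:R) :> R.
    by rewrite ler_ln ?posrE // (lt_le_trans l3).
  by apply: ler_wsqrtr; apply: ler_pM; [exact/ltW/mulr_gt0|exact: ltW|exact: Nl|exact: l5].
have S0 : 0 < S by rewrite sqrtr_gt0 !mulr_gt0.
have q0 : 0 <= 600 * C / D.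
  have p600 (c : R) : 0 <= c -> 0 <= 600 * c by move=> ?; lra.
  exact: divr_ge0 (p600 _ C0) (ltW D0).
have CG : 600 * C / D <= G.
  rewrite -(ger0_norm q0) -sqrtr_sqr; apply: ler_wsqrtr; apply: le_trans hC _.
  by rewrite (ler_peMr (ltW NR) l1).
rewrite ler_pdivlMr // => h.
have KM : 0 <= K * drift alpha eps by rewrite mulr_ge0 // (le_trans ler01).
have CG' : 600 * C <= G * D by rewrite -ler_pdivrMr.
have SG' : D * S <= D * G by rewrite ler_pM2l.
have hT' : D * G <= D * (300 * cos_sum N x) by rewrite ler_pM2l.
by lra.
Qed.

(** It suffices to look at eps = 2^(- N). *)
Lemma limsup_example K x : 0 <= K -> 0 <= x <= 1 ->
  (forall n, exists2 N, (n <= N)%N & Num.sqrt (N%:R * ln (ln N%:R)) <= 300 * cos_sum N x) ->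
  ((D / 600)%:E <= limf_esup (fun eps : R =>
      (Theta alpha eps (example alpha K) x /
        Num.sqrt (ln (1 / eps) * ln (ln (ln (1 / eps)))))%:E) 0^'+)%E.
Proof.
move=> K0 x01 H; have [N0 HN0] := large_scale.
rewrite limf_esupE; apply: le_ereal_inf_tmp => _ [V V0 <-].
have [e /= e0 eV] := V0.
have [N nN hT] := H (maxn N0 (Num.truncn e^-1).+1).
move: nN; rewrite geq_max => /andP[/HN0[h1 h2 h3] hN].
have Npos : (0 < N)%N by apply: leq_trans hN.
apply: (@le_trans _ _ ((Theta alpha (2 ^+ N)^-1 (example alpha K) x /
        Num.sqrt (ln (1 / (2 ^+ N)^-1) * ln (ln (ln (1 / (2 ^+ N)^-1)))))%:E)%E).
  by rewrite lee_fin; exact: Theta_large.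
apply: ereal_sup_ubound; exists (2 ^+ N)^-1 => //.
have P0 : 0 < 2 ^+ N :> R by rewrite exprn_gt0.
apply: eV; last by rewrite invr_gt0.
rewrite /= sub0r normrN gtr0_norm ?invr_gt0 // -[ltRHS]invrK ltf_pV2 ?posrE ?invr_gt0 //.
apply: lt_le_trans (truncnS_gt _) _; rewrite -natrX ler_nat.
exact: leq_trans hN (ltnW (ltn_expl N (isT : 1 < 2)%N)).
Qed.

(** One constant serves both conclusions; D / 1200 is half the bound of
    [limsup_example], which makes the last inequality strict. *)
Definition final_const (d : R) : R := Num.min (Num.min (d ^+ 2 / 4) 1) (d / 1200).

Lemma final_const_gt0 d : 0 < d -> 0 < final_const d.
Proof.
move=> d0; have d2 : 0 < d ^+ 2 by rewrite exprn_gt0.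
by rewrite !lt_min; apply/andP; split; first (apply/andP; split); lra.
Qed.

Lemma final_const_lt d : 0 < d -> final_const d < d / 600.
Proof. by move=> d0; rewrite gt_min; apply/orP; right; lra. Qed.

End limsup.

Unset Implicit Arguments.

Theorem mainTheorem4 (R : realType) (alpha : R)
    (alpha_gt0 : 0 < alpha) (alpha_lt1 : alpha < 1) :
  exists f : R -> R, exists c : R,
    [/\ holder_class alpha f,
        0 < c,
        forall eps : R, 0 < eps -> eps < 1 / 2 ->
          \int[@lebesgue_measure R]_(x in `[0, 1]) (`|Theta alpha eps f x| ^+ 2)
            >= c * ln (1 / eps)
      & {ae @lebesgue_measure R, forall x : R, x \in `[0, 1] ->
          (limf_esup
            (fun eps : R =>
              (Theta alpha eps f x /
               Num.sqrt (ln (1 / eps) * ln (ln (ln (1 / eps)))))%:E)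
            0^'+ > c%:E)%E}].
Proof.
have D0 := theta_const_gt0 alpha_gt0 alpha_lt1.
have C0 := lac_const_ge0 alpha_gt0 alpha_lt1.
set D := theta_const alpha in D0.
have slope0 : 0 <= slope alpha.
  by rewrite /slope /total_err -/D; lra.
pose c := final_const D.
exists (example alpha (slope alpha)), c; split.
- exact: example_holder.
- exact: final_const_gt0.
- move=> eps e0 e1; apply: le_trans (example_energy alpha_gt0 alpha_lt1 e0 e1).
  apply: ler_wpM2r; first by apply: ln_ge0; rewrite ler_pdivlMr // mul1r; lra.
  by rewrite ge_min lexx.
have null1 : (@lebesgue_measure R).-negligible [set 1].
  by exists [set 1]; split => //; exact: lebesgue_measure_set1.
apply: negligibleS (negligibleU (lacunary_lil R) null1) => x /= nx.
have [->|x1] := eqVneq x 1; [by right|left=> H; apply: nx].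
rewrite in_itv /= => x01.
have {}x1 : x \in `[0, 1[ by rewrite in_itv /= lt_neqAle x1 /=.
apply: lt_le_trans (limsup_example alpha_gt0 alpha_lt1 slope0 x01 (H x1)).
by rewrite lte_fin; exact: final_const_lt.
Qed.
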